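(* Let $d\ge 2$ and let $\mathcal{S}\subset\mathbb{R}^d$ be a scatterer configuration that is aperiodic and linearly repetitive, whose Lorentz gas has finite horizon, and which satisfies Hypothesis 1 (that is, the associated linearly repetitive Delone multiset $\Lambda_{\mathcal S}$ has a nice tower system $\mathcal{B}_n=\{C_{n,i}[D_{n,i}]\}_{i=1}^{k_n}$, $n\ge 0$, with $k_n>1$ for infinitely many $n$). Let $\mathcal{D}$ be the collision space, $F:\mathcal{D}\to\mathcal{D}$ the billiard map, $\mu$ the absolutely continuous $F$-invariant probability measure on $\mathcal{D}$, and $H_\alpha^\perp$ the space of transversally $\alpha$-Hölder functions on $\mathcal{D}$ with norm $\|\cdot\|_\alpha$. Then: (1) For every $\alpha>0$, $(\mathcal{D},F,\mu)$ is not exponentially mixing in $H_\alpha^\perp$: there are no $C>0$ and $\tau\in(0,1)$ such that $$\left|\int_{\mathcal D} \psi_1\circ F^n\cdot\psi_2\,d\mu-\mu(\psi_1)\mu(\psi_2)\right|\le C\|\psi_1\|_\alpha\|\psi_2\|_\alpha\,\tau^{n}\quad\text{for all } n\ge 0,\ \psi_1,\psi_2\in H_\alpha^\perp .$$ (2) For every $\alpha>0$, $(\mathcal{D},F,\mu)$ is not stretched exponentially mixing in $H_\alpha^\perp$: there are no $C>0$ and $\gamma,\tau\in(0,1)$ such that $$\left|\int_{\mathcal D} \psi_1\circ F^n\cdot\psi_2\,d\mu-\mu(\psi_1)\mu(\psi_2)\right|\le C\|\psi_1\|_\alpha\|\psi_2\|_\alpha\,\tau^{n^{\gamma}}\quad\text{for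 all } n\ge 0,\ \psi_1,\psi_2\in H_\alpha^\perp .$$ (3) If for some $\alpha>0$, $C>0$ and $\gamma$ we have $$\left|\int_{\mathcal D} \psi_1\circ F^n\cdot\psi_2\,d\mu-\mu(\psi_1)\mu(\psi_2)\right|\le C\|\psi_1\|_\alpha\|\psi_2\|_\alpha\, n^{-\gamma}\quad\text{for all } n\in\mathbb{N}=\{1,2,\dots\},\ \psi_1,\psi_2\in H_\alpha^\perp ,$$ then $\gamma\le 2(d+\alpha)$.
   Context: **Notation.** $\mu(\psi)=\int\psi\,d\mu$; $B_R(x)$ is the closed ball of radius $R$ about $x$ in $\mathbb{R}^d$. **Delone multisets.** A Delone set in $\mathbb{R}^d$ is a countable subset that is uniformly discrete (for some $r>0$ every ball of radius $r$ contains at most one of its points) and relatively dense (for some $R>0$ every ball of radius $R$ contains at least one of its points). A Delone multiset is a set $\Lambda=\bigcup_{i\in\mathfrak{C}}\Lambda_i\times\{i\}\subset\mathbb{R}^d\times\mathfrak{C}$ with $\mathfrak{C}$ finite and the $\Lambda_i$ pairwise disjoint Delone sets; $\pi(\Lambda)=\bigcup_i\Lambda_i$ is also a Delone set. Write $\varphi_t(\Lambda)=\bigcup_i(\Lambda_i-t)\times\{i\}$ for $t\in\mathbb{R}^d$. $\Lambda$ is aperiodic if $\varphi_t(\Lambda)=\Lambda$ implies $t=0$. Put $B_R^*(p)=B_R(p)\times\mathfrak{C}$. An $R$-cluster is a set $\Lambda\cap B_R^*(p)$ with $p\in\pi(\Lambda)$. $\Lambda$ has finite local complexity if for each $R>0$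 there are finitely many $R$-clusters up to translation. The repetitivity function $M_\Lambda(R)$ is the least $T$ such that every ball of radius $T$ contains a copy of every $R$-cluster $P$ of $\Lambda$, i.e. contains a point $p'\in\pi(\Lambda)$ such that $\Lambda\cap B_R^*(p')$ is, as a cluster centered at $p'$, a translate of $P$. $\Lambda$ is linearly repetitive (with constant $L$) if there is $L>1$ with $M_\Lambda(R)\le LR$ for all $R\ge 1$. Finite local complexity is assumed throughout. **Pattern space.** For two multisets let $d^*(\Lambda',\Lambda'')$ be the infimum of $\varepsilon>0$ for which there are $x,y\in B_\varepsilon(0)$ with $B^*_{1/\varepsilon}(0)\cap\varphi_x(\Lambda')=B^*_{1/\varepsilon}(0)\cap\varphi_y(\Lambda'')$, and $d(\Lambda',\Lambda'')=\min\{d^*(\Lambda',\Lambda''),2^{-1/2}\}$. The pattern space $\Omega_\Lambda$ is the completion of $\{\varphi_t(\Lambda):t\in\mathbb{R}^d\}$ with respect to the metric $d$; its elements are Delone multisets, it is compact, and $\varphi_t$ acts on it. The canonical transversal is $\mho_\Lambda=\{\Lambda'\in\Omega_\Lambda:0\in\pi(\Lambda')\}$. For $\Lambda'\in\Omega_\Lambda$, $R>0$, the cylinder is $C_{\Lambda',R}=\{\Lambda''\in\Omega_\Lambda:\Lambda''\cap B_R^*(0)=\Lambda'\cap B_R^*(0)\}$. A local transversal is a clopen subset of a cylinder. **Frequency measure.** If $\Lambda$ is linearly repetitive, the $\mathbb{R}^d$-action on $\Omega_\Lambda$ is uniquely ergodic and cluster frequencies exist and are independent of the element of $\Omega_\Lambda$.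 The frequency measure $\nu$ is the finite Borel measure on $\mho_\Lambda$ such that for every $R$-cluster $P$ (translated to be centered at $0$), the set $\mathcal{C}_P=\{\Lambda'\in\mho_\Lambda:\Lambda'\cap B_R^*(0)=P\}$ has measure $\nu(\mathcal{C}_P)=\lim_{T\to\infty}\frac{1}{\mathrm{Vol}(B_T(0))}\#\{\text{occurrences of translates of }P\text{ as an }R\text{-cluster of }\Lambda\text{ in }B_T(0)\}$. **Tower systems.** For a local transversal $C$ its recognition radius is $\mathrm{rec}(C)=\inf\{R>0:C_{\Lambda',R}\subset C\ \forall\Lambda'\in C\}$. For $D\subset\mathbb{R}^d$ open, $C[D]=\{\varphi_t(\Lambda'):t\in D,\Lambda'\in C\}$; it is a box if $(t,\Lambda')\mapsto\varphi_t(\Lambda')$ is a homeomorphism from $D\times C$ onto $C[D]$. A box decomposition of $\Omega_\Lambda$ is a finite collection of pairwise disjoint boxes $\mathcal{B}=\{C_i[D_i]\}_{i=1}^k$, with $0\in D_i$, whose closures cover $\Omega_\Lambda$. Put $r_{int}(\mathcal{B})=\min_i\sup\{R>0:B_R(0)\subset D_i\}$, $R_{ext}(\mathcal{B})=\max_i\inf\{R>0:D_i\subset B_R(0)\}$, $\mathrm{rec}(\mathcal{B})=\max_i\mathrm{rec}(C_i)$. A box decomposition $\mathcal{B}'=\{C_i'[D_i']\}_{i=1}^{k'}$ is zoomed out of $\mathcal{B}=\{C_j[D_j]\}_{j=1}^k$ if: (a) if $\Lambda'\in C_i'$ satisfies $\varphi_{x'}(\Lambda')\in\varphi_y(C_j)$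 for some $x'\in\overline{D_i'}$, $y\in\overline{D_j}$, then $\varphi_{x'}(C_i')\subset\varphi_y(C_j)$; (b) if $x'\in\partial D_i'$, there are $j$ and $y\in\partial D_j$ with $\varphi_{x'}(C_i')\subset\varphi_y(C_j)$; (c) for every $B'\in\mathcal{B}'$ there is $B\in\mathcal{B}$ with $B\cap B'\ne\varnothing$ and $\partial B\cap\partial B'=\varnothing$; (d) with $O_{i,j}=\{x'\in D_i':\varphi_{x'}(C_i')\subset C_j\}$, for each $i$ one has $\overline{D_i'}=\bigcup_j\bigcup_{x'\in O_{i,j}}(x'+\overline{D_j})$, the sets on the right having pairwise disjoint interiors; (e) $\bigcup_iC_i'\subset\bigcup_jC_j$. A tower system is a sequence $\{\mathcal{B}_n\}_{n\ge0}$ of box decompositions $\mathcal{B}_n=\{C_{n,i}[D_{n,i}]\}_{i=1}^{k_n}$ such that $\mathcal{B}_{n+1}$ is zoomed out of $\mathcal{B}_n$ for all $n$. It is adapted to a decreasing sequence $\{C_n\}$ of transversals with diameters tending to $0$ if $C_n=\bigcup_iC_{n,i}$ for all $n$. Its transition matrices have entries $m^{(n)}_{i,j}=\#\{x\in D_{n,i}:\varphi_x(C_{n,i})\subset C_{n-1,j}\}$. **Nice tower system.** Let $\Lambda$ be an aperiodic linearly repetitive Delone multiset with constant $L>1$, translated so that $0\in\pi(\Lambda)$ (this does not change $\Omega_\Lambda$). Let $\lambda=6L(L+1)^2$, $C_0=\mho_\Lambda$, $C_n=C_{\Lambda,\lambda^n}$ for $n>0$, $K_1=\frac1{2(L+1)}-\frac{L}{\lambda-1}$,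 $K_2=\frac{\lambda L}{\lambda-1}$ (so $0<K_1<1<K_2$). A nice tower system for $\Lambda$ is a tower system adapted to $\{C_n\}$ such that for all $n$: (i) $C_{n+1}\subset C_{n,1}$; (ii) $K_1\lambda^n\le r_{int}(\mathcal{B}_n)<R_{ext}(\mathcal{B}_n)\le K_2\lambda^n$; (iii) $\mathrm{rec}(\mathcal{B}_n)\le(2L+1)\lambda^n$; and the transition matrices have strictly positive entries and are uniformly bounded in size and norm. (Such systems are known to exist.) Hypothesis 1: the nice tower system has $k_n>1$ for infinitely many $n$. **Scatterers and the Lorentz gas.** A scatterer configuration $\mathcal{S}\subset\mathbb{R}^d$ is a countable collection of open convex topological balls (scatterers) with $C^{d-1}$ boundaries and pairwise disjoint closures. Let $\mathfrak{C}$ be the set of translation-equivalence classes of scatterers, $\Lambda_i^{\mathcal{S}}$ the set of centers of mass of scatterers in class $i$, and $\Lambda_{\mathcal{S}}=\bigcup_{i\in\mathfrak{C}}\Lambda_i^{\mathcal{S}}\times\{i\}$. $\mathcal{S}$ is called aperiodic, linearly repetitive, etc., if $\Lambda_{\mathcal{S}}$ is a Delone multiset with that property (in particular $\mathfrak{C}$ is finite). The Lorentz gas is the motion of a point particle in $\mathbb{R}^d\setminus\mathcal{S}$ in straight lines at unit speed with elastic (specular) reflections at $\partial\mathcal{S}$; it has finite horizon if there is $M$ such that the time between any two consecutive collisions is at most $M$. **Collision space and billiard map.** For $i\in\mathfrak{C}$ let $S_i$ be the representative of class $i$ with center of mass at $0$, let $\mathcal{C}_i\subset\mho_{\Lambda_{\mathcal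 S}}$ be the set of those $\Lambda'\in\mho_{\Lambda_{\mathcal S}}$ with $(0,i)\in\Lambda'$, and $$T^1_+(\partial S_i)=\{(x,v)\in\partial S_i\times\mathbb{R}^d:\|v\|=1,\ \exists\epsilon>0\text{ with }x+tv\notin S_i\text{ for }t\in(0,\epsilon)\}.$$ The collision space is $\mathcal{D}=\bigsqcup_{i\in\mathfrak{C}}T^1_+(\partial S_i)\times\mathcal{C}_i$. A point $(x,v,\Lambda')$ with $\Lambda'\in\mathcal{C}_i$ represents a particle leaving the point $x$ of the scatterer $S_i$ (centered at $0$) with velocity $v$ in the Lorentz gas with scatterers $\{p+S_j:(p,j)\in\Lambda'\}$. The billiard map $F:\mathcal{D}\to\mathcal{D}$ sends $(x,v,\Lambda')$ to $(y-p,v^+,\varphi_p(\Lambda'))$, where $y\in p+\partial S_j$, $(p,j)\in\Lambda'$, is the next collision point of this particle (necessarily with a different scatterer) and $v^+$ its velocity right after the elastic reflection there. **Measure.** An $F$-invariant measure $\mu$ on $\mathcal{D}$ is absolutely continuous if it is locally absolutely continuous with respect to $L_1\times\nu\times L_2$, with $L_1$ Lebesgue (surface) measure on $\partial S_i$, $\nu$ the frequency measure on $\mathcal{C}_i\subset\mho_{\Lambda_{\mathcal S}}$, and $L_2$ Lebesgue measure on the (hemi)sphere of outgoing unit directions. In the present uniquely ergodic setting the absolutely continuous $F$-invariant probability measure is taken to be unique (standing assertion); this ''natural'' measure is $\mu$. **Transversally Hölder functions.** For $\alpha>0$ and $\psi:\mathcal{D}\to\mathbb{R}$, $$|\psi|_\alpha^\perp=\max_{i\in\mathfrak{C}}\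 \sup_{(x,v)\in T^1_+(\partial S_i)}\ \sup_{c_1\ne c_2\in\mathcal{C}_i}\frac{|\psi(x,v,c_1)-\psi(x,v,c_2)|}{d(c_1,c_2)^\alpha},$$ $H_\alpha^\perp$ is the space of continuous $\psi:\mathcal{D}\to\mathbb{R}$ with $|\psi|_\alpha^\perp<\infty$, and $\|\psi\|_\alpha=\|\psi\|_{C^0}+|\psi|_\alpha^\perp$. *)

(* Defs.v *)
(* The library norm of ['rV[R]_d] is the max norm, hence [enorm] and [cball] for
   Euclidean lengths and closed balls; the topology is the same. *)
From HB Require Import structures.
From mathcomp Require Import all_boot all_order all_algebra finmap ring lra.
From mathcomp Require Import all_classical all_reals all_analysis.

Set Implicit Arguments.
Unset Strict Implicit.
Unset Printing Implicit Defensive.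

Import Order.TTheory GRing.Theory Num.Theory.
Import numFieldNormedType.Exports.

Local Open Scope classical_set_scope.
Local Open Scope ring_scope.

Notation borel T := (g_sigma_algebraType (@open T)).

(* 0 for an infinite set *)
Definition count_set (T : choiceType) (A : set T) : nat := #|` fset_set A|.

Definition frontier (T : topologicalType) (A : set T) : set T :=
  closure A `&` closure (~` A).

Section Euclidean.
Context {R : realType} {d : nat}.
Implicit Types (x y c : 'rV[R]_d) (A : set 'rV[R]_d).

Definition dotp x y : R := \sum_i x 0 i * y 0 i.

Definition enorm x : R := Num.sqrt (dotp x x).

Definition cball c (r : R) : set 'rV[R]_d := [set y | enorm (y - c) <= r].

Definition shift_set (t : 'rV[R]_d) A : set 'rV[R]_d := [set x + t | x in A].

Lemma dotp_ge0 x : 0 <= dotp x x.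
Proof. by apply: sumr_ge0 => i _; rewrite -expr2 sqr_ge0. Qed.

Lemma dotpC x y : dotp x y = dotp y x.
Proof. by apply: eq_bigr => i _; rewrite mulrC. Qed.

Lemma dotpDl x y c : dotp (x + y) c = dotp x c + dotp y c.
Proof.
by rewrite -big_split; apply: eq_bigr => i _; rewrite !mxE mulrDl.
Qed.

Lemma dotpZl a x y : dotp (a *: x) y = a * dotp x y.
Proof. by rewrite mulr_sumr; apply: eq_bigr => i _; rewrite !mxE mulrA. Qed.

Lemma dotp_CS x y : dotp x y ^+ 2 <= dotp x x * dotp y y.
Proof.
have [B0|] := eqVneq (dotp y y) 0.
  have y0 : y = 0.
    apply/rowP => i; rewrite mxE; apply/eqP; rewrite -sqrf_eq0 expr2.
    move/eqP: B0; rewrite /dotp psumr_eq0; last first.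
      by move=> j _; rewrite -expr2 sqr_ge0.
    by move=> /allP /(_ i); rewrite mem_index_enum => /(_ isT).
  rewrite B0 mulr0 y0 /dotp big1 ?expr0n //.
  by move=> i _; rewrite mxE mulr0.
move=> Bn0; have B_gt0 : 0 < dotp y y by rewrite lt_def Bn0 dotp_ge0.
have := dotp_ge0 (dotp y y *: x + (- dotp x y) *: y).
rewrite dotpDl !dotpZl !(dotpC _ (_ + _)) !dotpDl !dotpZl (dotpC y x) => H.
rewrite -subr_ge0 -(pmulr_rge0 _ B_gt0).
by apply: le_trans H _; rewrite le_eqVlt; apply/orP; left; apply/eqP; ring.
Qed.

Lemma enorm_ge0 x : 0 <= enorm x.
Proof. exact: sqrtr_ge0. Qed.

Lemma enorm0 : enorm 0 = 0.
Proof.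
rewrite /enorm /dotp big1 ?sqrtr0 // => i _.
by rewrite mxE mulr0.
Qed.

Lemma enormN x : enorm (- x) = enorm x.
Proof.
by congr Num.sqrt; apply: eq_bigr => i _; rewrite !mxE mulrNN.
Qed.

Lemma enormD x y : enorm (x + y) <= enorm x + enorm y.
Proof.
have sq z : enorm z ^+ 2 = dotp z z by rewrite sqr_sqrtr ?dotp_ge0.
have xy : dotp x y <= enorm x * enorm y.
  apply: le_trans (ler_norm _) _.
  rewrite -(@ler_pXn2r _ 2) ?nnegrE ?mulr_ge0 ?enorm_ge0 //.
  by rewrite real_normK ?num_real // exprMn !sq dotp_CS.
rewrite -(@ler_pXn2r _ 2) ?nnegrE ?addr_ge0 ?enorm_ge0 //.
rewrite sqrrD !sq dotpDl !(dotpC _ (_ + _)) !dotpDl (dotpC y x).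
move: xy; set a := dotp x x; set b := dotp y y; set p := dotp x y.
by set q := enorm x * enorm y => pq; lra.
Qed.

End Euclidean.

(* A multiset with colours in [I] is a set of pairs (point, colour); in
   particular intersecting it with a ball times all of [I], or times the set of
   colours that it uses, is the same. *)
Definition multiset (R : realType) (d : nat) (I : Type) :=
  set ('rV[R]_d * I)%type.

Section Multiset.
Context {R : realType} {d : nat} {I : Type}.
Local Notation rV := 'rV[R]_d.
Local Notation mset := (multiset R d I).
Implicit Types (L : mset) (x y p t : rV) (r e : R).

HB.instance Definition _ := gen_eqMixin mset.
HB.instance Definition _ := gen_choiceMixin mset.
HB.instance Definition _ := isPointed.Build mset set0.

Definition phi t L : mset := [set z | L (z.1 + t, z.2)].

Definition supp L : set rV := [set p | exists i, L (p, i)].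

Definition bstar r p : mset := [set z | cball p r z.1].

Definition dstar_set (L1 L2 : mset) : set R := [set e | 0 < e /\
  exists x y, [/\ cball 0 e x, cball 0 e y &
    bstar e^-1 0 `&` phi x L1 = bstar e^-1 0 `&` phi y L2]].

Definition dstar (L1 L2 : mset) : \bar R :=
  ereal_inf [set e%:E | e in dstar_set L1 L2].

Definition mset_dist (L1 L2 : mset) : R :=
  fine (Order.min (dstar L1 L2) ((Num.sqrt 2)^-1)%:E).

Let s : R := (Num.sqrt 2)^-1.

Lemma mset_dist_lt L1 L2 e :
  mset_dist L1 L2 < e <-> s < e \/ exists2 a, a < e & dstar_set L1 L2 a.
Proof.
rewrite /mset_dist -/s; have ge0 : (0 <= dstar L1 L2)%E.
  by apply/ereal_infP => _ [a [a0 _] <-]; rewrite lee_fin ltW.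
have fn : Order.min (dstar L1 L2) s%:E \is a fin_num.
  rewrite ge0_fin_numE.
    by rewrite gt_min ltry orbT.
  by rewrite le_min ge0 lee_fin invr_ge0 sqrtr_ge0.
rewrite -lte_fin fineK // gt_min; split.
  move=> /orP[|]; last by rewrite lte_fin => ?; left.
  by move=> /ereal_inf_lt [_ [a Ea <-]]; rewrite lte_fin => ae; right; exists a.
move=> [se|[a ae Ea]]; apply/orP; [by right; rewrite lte_fin|left].
apply: (@le_lt_trans _ _ a%:E); rewrite ?lte_fin //.
by apply: ge_ereal_inf; exists a%:E => //; exists a.
Qed.

Definition mball L1 e L2 : Prop := mset_dist L1 L2 < e.

Lemma phi_phi x y L : phi x (phi y L) = phi (x + y) L.
Proof. by apply/seteqP; split=> -[p i] /=; rewrite /phi /= addrA. Qed.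

Lemma phi0 L : phi 0 L = L.
Proof. by apply/seteqP; split=> -[p i] /=; rewrite /phi /= addr0. Qed.

Lemma mball_center L e : 0 < e -> mball L e L.
Proof.
move=> e0; apply/mset_dist_lt; right; exists (e / 2); first by lra.
split; first by lra.
by exists 0, 0; split => //; rewrite /cball /= subr0 enorm0; lra.
Qed.

Lemma dstar_set_sym L1 L2 a : dstar_set L1 L2 a -> dstar_set L2 L1 a.
Proof. by move=> [a0 [x [y [? ? ?]]]]; split=> //; exists y, x; split. Qed.

Lemma mball_sym L1 L2 e : mball L1 e L2 -> mball L2 e L1.
Proof.
move=> /mset_dist_lt H; apply/mset_dist_lt; case: H => [|[a ae]]; first by left.
by move=> /dstar_set_sym ?; right; exists a.
Qed.

Lemma mset_dist_shrink L1 L2 (r r' : R) t : enorm t + r' <= r ->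
  bstar r 0 `&` L1 = bstar r 0 `&` L2 ->
  bstar r' 0 `&` phi t L1 = bstar r' 0 `&` phi t L2.
Proof.
move=> rr' /seteqP[L12 L21].
have rp p : cball 0 r' p -> cball 0 r (p + t).
  rewrite /cball /= !subr0 => pr'.
  apply: le_trans (enormD _ _) _; rewrite addrC; apply: le_trans rr'.
  by rewrite lerD2l.
apply/seteqP; split=> -[p i] [/= pr' Lp]; split=> //.
  by case: (L12 (p + t, i)) => //; split=> //; apply: rp.
by case: (L21 (p + t, i)) => //; split=> //; apply: rp.
Qed.

Lemma dstar_set_tri L1 L2 L3 a b : a + b < s ->
  dstar_set L1 L2 a -> dstar_set L2 L3 b -> dstar_set L1 L3 (a + b).
Proof.
move=> abs [a0 [x [y [xa ya H12]]]] [b0 [x' [y' [xb yb H23]]]].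
have s2 : s ^+ 2 = 2^-1 by rewrite exprVn sqr_sqrtr.
have s0 : 0 < s by rewrite invr_gt0 sqrtr_gt0.
have ab1 : (a + b) ^+ 2 < 2^-1 by rewrite -s2 ltr_pXn2r ?nnegrE //; lra.
have inv (u v : R) : 0 < u -> 0 < v -> (u + v) ^+ 2 < 2^-1 ->
    v + (u + v)^-1 <= u^-1.
  move=> u0 v0 uv1; have uv0 : 0 < u + v by lra.
  rewrite -subr_ge0.
  have -> : u^-1 - (v + (u + v)^-1) = v * (1 - u * (u + v)) / (u * (u + v)).
    by field; apply/andP; split; lra.
  apply: divr_ge0; last by rewrite mulr_ge0 // ltW.
  by apply: mulr_ge0; first exact: ltW; nra.
split; first by lra.
exists (x' + x), (y + y'); move: xa ya xb yb; rewrite /cball /= !subr0.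
move=> xa ya xb yb; split.
- by apply: le_trans (enormD _ _) _; rewrite addrC lerD.
- by apply: le_trans (enormD _ _) _; rewrite lerD.
transitivity (bstar (a + b)^-1 0 `&` phi x' (phi y L2)).
  rewrite -phi_phi; apply: (mset_dist_shrink _ H12).
  by apply: le_trans (inv _ _ a0 b0 ab1); rewrite lerD2r.
rewrite phi_phi [x' + y]addrC -!phi_phi; apply: (mset_dist_shrink _ H23).
rewrite [a + b]addrC; apply: le_trans (inv _ _ b0 a0 _).
  by rewrite lerD2r.
by rewrite addrC.
Qed.

Lemma mball_triangle L1 L2 L3 e1 e2 :
  mball L1 e1 L2 -> mball L2 e2 L3 -> mball L1 (e1 + e2) L3.
Proof.
have s0 : 0 < s by rewrite invr_gt0 sqrtr_gt0.
have pos L L' e : mball L e L' -> 0 < e.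
  by move=> /mset_dist_lt[|[a ae [a0 _]]]; [exact: lt_trans|exact: lt_trans ae].
move=> B12 B23; have e1_gt0 := pos _ _ _ B12; have e2_gt0 := pos _ _ _ B23.
apply/mset_dist_lt.
have [|se] := ltP s (e1 + e2); first by left.
right; move/mset_dist_lt: B12 => [|[a ae Ea]]; first by lra.
move/mset_dist_lt: B23 => [|[b be Eb]]; first by lra.
by exists (a + b); [rewrite ltrD|apply: dstar_set_tri Ea Eb; lra].
Qed.

HB.instance Definition _ := hasNbhs.Build mset (nbhs_ (entourage_ mball)).
HB.instance Definition _ := Nbhs_isPseudoMetric.Build R mset
  erefl mball_center mball_sym mball_triangle erefl.

Definition uniformly_discrete (X : set rV) : Prop := exists2 r, 0 < r &
  forall c x y, (X `&` cball c r) x -> (X `&` cball c r) y -> x = y.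

Definition relatively_dense (X : set rV) : Prop := exists2 r, 0 < r &
  forall c, X `&` cball c r !=set0.

Definition delone (X : set rV) : Prop :=
  [/\ countable X, uniformly_discrete X & relatively_dense X].

Definition layer L (i : I) : set rV := [set p | L (p, i)].

Definition delone_multiset (colors : set I) L : Prop := [/\ finite_set colors,
  forall z, L z -> colors z.2,
  forall i, colors i -> delone (layer L i),
  forall i j, colors i -> colors j -> i <> j -> layer L i `&` layer L j = set0
  & delone (supp L)].

Definition aperiodic L : Prop := forall t, phi t L = L -> t = 0.

(* the [r]-cluster of [L] at [p], translated so as to be centered at 0 *)
Definition centered_cluster L r p : mset := bstar r 0 `&` phi p L.

Definition finite_local_complexity L : Prop :=
  forall r, 0 < r -> finite_set [set centered_cluster L r p | p in supp L].

Definition repetitivity L r : \bar R := ereal_inf [set T%:E | T in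
  [set T | 0 <= T /\ forall c p, supp L p ->
    exists q, [/\ supp L q, cball c T q &
                  centered_cluster L r q = centered_cluster L r p]]].

Definition linearly_repetitive_with (Lc : R) L : Prop :=
  1 < Lc /\ forall r, 1 <= r -> (repetitivity L r <= (Lc * r)%:E)%E.

Definition linearly_repetitive L : Prop :=
  exists Lc, linearly_repetitive_with Lc L.

(* The completion of the orbit of [L], realized concretely as the set of the
   multisets that are limits of translates of [L] for [mset_dist]; when [L] is a
   Delone multiset of finite local complexity these limits are again Delone
   multisets and [mset_dist] separates them. *)
Definition hull L : set mset := closure (range (phi^~ L)).

Definition canonical_transversal L : set mset :=
  [set L' | hull L L' /\ supp L' 0].

Definition cylinder (Om : set mset) L r : set mset :=
  [set L' | Om L' /\ bstar r 0 `&` L' = bstar r 0 `&` L].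

Definition local_transversal (Om C : set mset) : Prop :=
  exists L r, [/\ Om L, 0 < r,
    exists2 U, open U & C = cylinder Om L r `&` U &
    exists2 V, closed V & C = cylinder Om L r `&` V].

Definition rec_radius (Om C : set mset) : \bar R := ereal_inf [set r%:E | r in
  [set r | 0 < r /\ forall L, C L -> cylinder Om L r `<=` C]].

Definition box (C : set mset) (D : set rV) : set mset :=
  [set phi z.1 z.2 | z in D `*` C].

Definition is_box (C : set mset) (D : set rV) : Prop :=
  open D /\
  {within D `*` C, continuous (fun z : rV * mset => phi z.1 z.2)} /\
  exists g : mset -> rV * mset, {within box C D, continuous g} /\
    forall z, (D `*` C) z -> g (phi z.1 z.2) = z.

Record box_family := BoxFamily {
  nbox : nat;
  base : 'I_nbox -> set mset;
  dom : 'I_nbox -> set rV }.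

Definition fbox (B : box_family) (i : 'I_(nbox B)) : set mset :=
  box (@base B i) (@dom B i).

Definition box_decomposition (Om : set mset) (B : box_family) : Prop := [/\
  forall i, [/\ local_transversal Om (@base B i),
                is_box (@base B i) (@dom B i) & @dom B i 0],
  forall i j, i != j -> @fbox B i `&` @fbox B j = set0
  & Om `<=` \bigcup_i closure (@fbox B i)].

Definition r_int (B : box_family) : \bar R :=
  \big[Order.min/+oo%E]_(i < nbox B)
    ereal_sup [set r%:E | r in [set r | 0 < r /\ cball 0 r `<=` @dom B i]].

Definition R_ext (B : box_family) : \bar R :=
  \big[Order.max/-oo%E]_(i < nbox B)
    ereal_inf [set r%:E | r in [set r | 0 < r /\ @dom B i `<=` cball 0 r]].

Definition rec_family (Om : set mset) (B : box_family) : \bar R :=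
  \big[Order.max/-oo%E]_(i < nbox B) rec_radius Om (@base B i).

(* boundary relative to the subspace [Om] *)
Definition frontier_in (Om A : set mset) : set mset :=
  Om `&` closure A `&` closure (Om `\` A).

Definition returns (B' B : box_family) (i : 'I_(nbox B')) (j : 'I_(nbox B)) :
    set rV :=
  [set x | @dom B' i x /\ phi x @` @base B' i `<=` @base B j].

Definition zoomed_out (Om : set mset) (B' B : box_family) : Prop :=
  [/\ forall i j L x y, @base B' i L ->
        closure (@dom B' i) x -> closure (@dom B j) y ->
        (phi y @` @base B j) (phi x L) ->
        phi x @` @base B' i `<=` phi y @` @base B j,
      forall i x, frontier (@dom B' i) x ->
        exists j y, frontier (@dom B j) y /\
          phi x @` @base B' i `<=` phi y @` @base B j,
      forall i, exists j, @fbox B j `&` @fbox B' i !=set0 /\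
        frontier_in Om (@fbox B j) `&` frontier_in Om (@fbox B' i) = set0,
      forall i, closure (@dom B' i) =
          \bigcup_j \bigcup_(x in @returns B' B i j)
            shift_set x (closure (@dom B j)) /\
        forall j k x y, @returns B' B i j x -> @returns B' B i k y ->
          (j, x) <> (k, y) ->
          interior (shift_set x (closure (@dom B j))) `&`
          interior (shift_set y (closure (@dom B k))) = set0
    & \bigcup_i @base B' i `<=` \bigcup_j @base B j].

Definition tower_system (Om : set mset) (B : nat -> box_family) : Prop :=
  (forall n, box_decomposition Om (B n)) /\
  (forall n, zoomed_out Om (B n.+1) (B n)).

Definition adapted (B : nat -> box_family) (C : nat -> set mset) : Prop :=
  [/\ forall n, C n.+1 `<=` C n,
      forall e, 0 < e -> exists N, forall n, (N <= n)%N ->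
        forall L1 L2, C n L1 -> C n L2 -> mset_dist L1 L2 < e
    & forall n, C n = \bigcup_i @base (B n) i].

(* The counts are finite for the towers of interest; a positive entry is the
   cardinality of a finite nonempty set.  [transition B n] is the matrix from
   level [n.+1] to level [n]. *)
Definition transition (B : nat -> box_family) (n : nat) :
    'M[R]_(nbox (B n.+1), nbox (B n)) :=
  \matrix_(i, j) (count_set (@returns (B n.+1) (B n) i j))%:R.

Definition nice_base (Lc : R) L (n : nat) : set mset :=
  if n is 0%N then canonical_transversal L
  else cylinder (hull L) L ((6 * Lc * (Lc + 1) ^+ 2) ^+ n).

(* Boxes are indexed from 0, so the first one is the ordinal with value 0. *)
Definition nice_tower_system (Lc : R) L (B : nat -> box_family) : Prop :=
  let lambda := 6 * Lc * (Lc + 1) ^+ 2 in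
  let K1 := (2 * (Lc + 1))^-1 - Lc / (lambda - 1) in
  let K2 := lambda * Lc / (lambda - 1) in
  tower_system (hull L) B /\ adapted B (nice_base Lc L) /\
  (forall n, [/\
    exists i, nat_of_ord i = 0%N /\ nice_base Lc L n.+1 `<=` @base (B n) i,
    ((K1 * lambda ^+ n)%:E <= r_int (B n))%E /\ (r_int (B n) < R_ext (B n))%E /\
    (R_ext (B n) <= (K2 * lambda ^+ n)%:E)%E
    & (rec_family (hull L) (B n) <= ((2 * Lc + 1) * lambda ^+ n)%:E)%E]) /\
  (forall n i j, 0 < transition B n i j) /\
  (exists N : R, forall n,
    (nbox (B n))%:R <= N /\ `|transition B n| <= N).

(* The translation by [t] puts a point of [L] at the origin. *)
Definition nontrivial_nice_tower L : Prop := exists Lc t B,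
  [/\ linearly_repetitive_with Lc L, supp L t,
      nice_tower_system Lc (phi t L) B
    & forall N, exists2 n, (N <= n)%N & (1 < nbox (B n))%N].

End Multiset.

(* The Lebesgue integral over R^d as an iterated integral. *)
Fixpoint leb_integral {R : realType} (d : nat) :
    ('rV[R]_d -> \bar R) -> \bar R :=
  match d with
  | 0%N => fun f => f 0
  | n.+1 => fun f => (\int[lebesgue_measure]_t
      leb_integral (fun y : 'rV[R]_n => f (row_mx (t%:M : 'rV[R]_1) y)))%E
  end.

Section Scatterers.
Context {R : realType} {d : nat}.
Local Notation rV := 'rV[R]_d.

Definition vol (A : set rV) : \bar R := leb_integral (fun x => (\1_A x)%:E).

Definition centroid (s : set rV) : rV :=
  \row_k (fine (leb_integral (fun x => (x 0 k * \1_s x)%:E)) / fine (vol s)).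

Fixpoint Ck (k : nat) (U : set rV) (f : rV -> R) : Prop :=
  (forall x, U x -> {for x, continuous f}) /\
  if k is k'.+1 then
    forall v, (forall x, U x -> derivable f x v) /\ Ck k' U ('D_v f)
  else True.

(* Locally the boundary is a regular level set of a C^k function. *)
Definition Ck_frontier (k : nat) (s : set rV) : Prop :=
  forall x, frontier s x -> exists U f, [/\ open U, U x, Ck k U f,
    exists v, 'D_v f x != 0 & s `&` U = [set y | f y < 0] `&` U].

(* A bounded nonempty open convex set is an open topological ball whose closure
   is a closed one. *)
Definition scatterer (s : set rV) : Prop :=
  [/\ open s, s !=set0, convex_set (s : set (convex_lmodType rV)),
      bounded_set s & Ck_frontier d.-1 s].

Definition scatterer_configuration (S : set (set rV)) : Prop :=
  [/\ countable S, forall s, S s -> scatterer s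
    & forall s s', S s -> S s' -> s <> s' -> closure s `&` closure s' = set0].

(* A colour is a class of scatterers up to translation, as a set of sets. *)
Definition color : Type := set (set rV).

Local Notation mset := (multiset R d color).

Definition class_of (S : set (set rV)) (s : set rV) : color :=
  [set s' | S s' /\ exists t, s' = shift_set t s].

Definition colors (S : set (set rV)) : set color := class_of S @` S.

Definition Lambda (S : set (set rV)) : mset :=
  [set (centroid s, class_of S s) | s in S].

(* The representative of the class whose center of mass is at 0. *)
Definition rep (c : color) : set rV :=
  [set x | exists2 s, c s & s (x + centroid s)].

Definition scatterers_of (L : mset) : set (set rV) :=
  [set shift_set z.1 (rep z.2) | z in L].

Definition T1plus (s : set rV) : set (rV * rV) := [set xv |
  [/\ frontier s xv.1, enorm xv.2 = 1 &
      exists2 e : R, 0 < e &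
        forall t : R, 0 < t < e -> ~ s (xv.1 + t *: xv.2)]].

(* A particle leaving the scatterer [s] from [x] with velocity [v] has its next
   collision at time [t], with the scatterer [s'] of [K]. *)
Definition next_collision (K : set (set rV)) (s : set rV) (x v : rV) (t : R)
    (s' : set rV) : Prop :=
  [/\ K s', s' <> s, 0 < t, frontier s' (x + t *: v) &
      forall (u : R) s'', 0 < u < t -> K s'' -> s'' <> s ->
        ~ frontier s'' (x + u *: v)].

(* In particular every particle leaving a scatterer has a next collision. *)
Definition finite_horizon (S : set (set rV)) : Prop :=
  exists M : R, forall s x v, S s -> T1plus s (x, v) ->
    exists t s', next_collision S s x v t s' /\ t <= M.

(* This determines [n] when [s] is convex with a C^1 boundary at [y]. *)
Definition outer_unit_normal (s : set rV) (y n : rV) : Prop :=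
  enorm n = 1 /\ forall z, s z -> dotp (z - y) n <= 0.

Definition reflect_vel (n v : rV) : rV := v - (2 * dotp v n) *: n.

Definition phase_space : Type :=
  (discrete_topology color * (rV * rV) * mset)%type.

HB.instance Definition _ := Topological.on phase_space.
HB.instance Definition _ := Pointed.on phase_space.

(* The point (x, v, L') of the component i is encoded as (i, (x, v), L'). *)
Definition collision_space (S : set (set rV)) : set phase_space :=
  [set z | [/\ colors S z.1.1, T1plus (rep z.1.1) z.1.2,
               canonical_transversal (Lambda S) z.2 & z.2 (0, z.1.1)]].

Definition billiard_step (z z' : phase_space) : Prop :=
  let: (i, (x, v), L) := z in
  let: (j, (x', v'), L') := z' in
  exists t p n,
    [/\ L (p, j),
        next_collision (scatterers_of L) (rep i) x v t (shift_set p (rep j)),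
        outer_unit_normal (shift_set p (rep j)) (x + t *: v) n &
        [/\ x' = x + t *: v - p, v' = reflect_vel n v & L' = phi p L]].

(* On the collision space of a configuration with finite horizon the next
   collision exists and is unique, so that the default value is not used. *)
Definition billiard_map (z : phase_space) : phase_space :=
  xget z (billiard_step z).

Definition frequency_measure (L : mset)
    (nu : {finite_measure set (borel mset) -> \bar R}) : Prop :=
  nu (~` canonical_transversal L) = 0%E /\
  forall r p, 0 < r -> supp L p ->
    (fun T : R => (count_set [set q | [/\ supp L q, cball 0 T q &
                    centered_cluster L r q = centered_cluster L r p]])%:R
                  / fine (vol (cball 0 T))) x @[x --> +oo]
    --> fine (nu [set L' | canonical_transversal L L' /\
                           bstar r 0 `&` L' = centered_cluster L r p]).

End Scatterers.

Arguments color R d : clear implicits.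
Arguments phase_space R d : clear implicits.

(* [r n] bounds the diameter of the [n]-th set of the covering. *)
Definition hausdorff_delta {R : realType} {d : nat} (k : nat) (delta : R)
    (A : set 'rV[R]_d) : \bar R :=
  ereal_inf [set (\sum_(n <oo) ((r n) ^+ k)%:E)%E | r in
    [set r : nat -> R | exists U : nat -> set 'rV[R]_d,
      A `<=` \bigcup_n U n /\
      forall n, 0 <= r n <= delta /\
        forall x y, U n x -> U n y -> enorm (x - y) <= r n]].

(* The k-dimensional Hausdorff measure, with the normalization that makes it
   the k-dimensional volume on k-dimensional C^1 submanifolds. *)
Definition hausdorff {R : realType} {d : nat} (k : nat) (A : set 'rV[R]_d) :
    \bar R :=
  ((fine (vol (cball (0 : 'rV[R]_k) 1)) / 2 ^+ k)%:E *
   ereal_sup [set hausdorff_delta k delta A |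
                delta in [set e : R | (0 < e)%R]])%E.

Section Mixing.
Context {R : realType} {d : nat}.
Local Notation rV := 'rV[R]_d.
Local Notation mset := (multiset R d (color R d)).
Local Notation Z := (phase_space R d).

Definition hypersurface_measure (M : set rV)
    (m : {finite_measure set (borel rV) -> \bar R}) : Prop :=
  forall A : set (borel rV), measurable A -> m A = hausdorff d.-1 (A `&` M).

Definition invariant_probability (D : set Z) (F : Z -> Z)
    (mu : probability (borel Z) R) : Prop :=
  mu (~` D) = 0%E /\
  forall A : set (borel Z), measurable A -> A `<=` D ->
    mu (D `&` F @^-1` A) = mu A.

Definition locally_abs_continuous (S : set (set rV))
    (L1 : color R d -> {finite_measure set (borel rV) -> \bar R})
    (nu : {finite_measure set (borel mset) -> \bar R})
    (L2 : {finite_measure set (borel rV) -> \bar R})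
    (mu : probability (borel Z) R) : Prop :=
  forall z, collision_space S z -> exists U : set Z, [/\ open U, U z &
    forall A : set (borel Z), measurable A -> A `<=` U `&` collision_space S ->
      (forall i, colors S i ->
        (L1 i \x nu \x L2)%E
          [set w | A ((i, (w.1.1, w.2), w.1.2) : Z)] = 0%E) ->
      mu A = 0%E].

Context (D : set Z) (alpha : R).
Implicit Types psi : Z -> R.

Definition holder_seminorm psi : \bar R := ereal_sup [set h |
  exists z1 z2 : Z, [/\ D z1, D z2, z1.1 = z2.1, z1.2 <> z2.2 &
    h = (`|psi z1 - psi z2| / mset_dist z1.2 z2.2 `^ alpha)%:E]].

Definition sup_norm psi : \bar R := ereal_sup [set (`|psi z|)%:E | z in D].

Definition holder_space : set (Z -> R) :=
  [set psi | {within D, continuous psi} /\ (holder_seminorm psi < +oo)%E].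

Definition holder_norm psi : \bar R := (sup_norm psi + holder_seminorm psi)%E.

Definition correlation (mu : probability (borel Z) R) (F : Z -> Z) (n : nat)
    psi1 psi2 : \bar R :=
  (\int[mu]_(z in D) (psi1 (iter n F z) * psi2 z)%:E -
   (\int[mu]_(z in D) (psi1 z)%:E) * (\int[mu]_(z in D) (psi2 z)%:E))%E.

Definition correlation_bound (mu : probability (borel Z) R) (F : Z -> Z)
    (n : nat) (b : R) : Prop :=
  forall psi1 psi2, holder_space psi1 -> holder_space psi2 ->
    (`|correlation mu F n psi1 psi2| <=
       b%:E * holder_norm psi1 * holder_norm psi2)%E.

End Mixing.

(* Main.v *)
(* Two observables that depend only on large clusters decorrelate slowly.  By
   repetitivity there are at most O(r^d) clusters of radius r, so one of them,
   P, satisfies mu(A) >= const * r^-d for the event A that the particle leaves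
   the center of a copy of P.  By finite horizon the particle moves a distance
   O(n) in n collisions, so that, if B is the event that there is no copy of P
   within distance c r, then a point of B is not mapped into A during the first
   const * r collisions and the correlation of the indicators of A and B equals
   - mu(A) mu(B).  Copies of P repel each other (aperiodicity and linear
   repetitivity), hence the complement of B has a small frequency when c is
   small, and absolute continuity gives mu(B) >= 1/2.  The Hoelder norms of the
   indicators are O(r^alpha); comparing gives the decay exponent at most
   d + 2 alpha. *)
Require Import Defs.
From mathcomp Require Import all_boot all_order all_algebra finmap ring lra.
From mathcomp Require Import all_classical all_reals all_analysis.
From mathcomp Require Import measurable_realfun.

Set Implicit Arguments.
Unset Strict Implicit.
Unset Printing Implicit Defensive.

Import Order.TTheory GRing.Theory Num.Theory.
Import numFieldNormedType.Exports.

Local Open Scope classical_set_scope.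
Local Open Scope ring_scope.

(** * Iterated integrals of lower semicontinuous functions *)

(** Two obstacles shape the proof. First, [mu] is only absolutely continuous, with no bound on a
    density, so a small [nu]-measure does not give a small [mu]-measure uniformly in the scale.
    Hence the sparseness of neighborhoods of copies is proved with an arbitrary factor [m], and the
    choice of [c] is made by contradiction. The bound from below for the frequent cluster is a
    pigeonhole argument carried out with [mu] itself. Second, finite horizon concerns the scatterers
    of [S], whereas the particle moves among those of an arbitrary element of the hull. To transfer
    it, that element has to be locally a translate of [Lambda S], and [rep] has to be a translate of
    every scatterer of its class. This is translation equivariance of the center of mass. As volumes
    are iterated integrals, it is derived for nonnegative lower semicontinuous functions, a class
    that is stable under partial integration and therefore supplies measurability at each stage. *)

Lemma continuous_pair (X Y Z : topologicalType) (f : X -> Y) (g : X -> Z) :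
  continuous f -> continuous g -> continuous (fun x => (f x, g x)).
Proof. by move=> cf cg x; apply: (cvg_pair (cf x) (cg x)). Qed.

Lemma continuous_compT (X Y Z : topologicalType) (f : X -> Y) (g : Y -> Z) :
  continuous f -> continuous g -> continuous (g \o f).
Proof. by move=> cf cg x; apply: continuous_comp; [exact: cf|exact: cg]. Qed.

Lemma continuous_fst (X Y : topologicalType) : continuous (@fst X Y).
Proof. by move=> x; exact: cvg_fst. Qed.

Lemma continuous_snd (X Y : topologicalType) : continuous (@snd X Y).
Proof. by move=> x; exact: cvg_snd. Qed.

Section LowerSemicontinuous.
Context {R : realType}.
Local Open Scope ereal_scope.
Local Notation leb := (@lebesgue_measure R).

Lemma lsc_comp (X Y : topologicalType) (g : X -> Y) (f : Y -> \bar R) :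
  continuous g -> lower_semicontinuous f -> lower_semicontinuous (f \o g).
Proof.
move=> cg /lower_semicontinuousP lf; apply/lower_semicontinuousP => a.
rewrite (_ : [set x | _] = g @^-1` [set y | f y > a%:E]) //.
by apply: open_comp => // x _; exact: cg.
Qed.

Lemma lsc_section (X : topologicalType) (h : X * R -> \bar R) x :
  lower_semicontinuous h -> lower_semicontinuous (fun t => h (x, t)).
Proof.
move=> lh; apply: (lsc_comp (g := fun t => (x, t)) _ lh).
by apply: continuous_pair => t; [exact: cvg_cst|exact: cvg_id].
Qed.

Lemma lsc_le_limn_einf (X : pseudoMetricType R) (f : X -> \bar R) (u : nat -> X)
  x : lower_semicontinuous f -> u @ \oo --> x -> f x <= limn_einf (f \o u).
Proof.
move=> lf ux; rewrite leNgt; apply/negP => lfx.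
have [r lr rfx] : exists2 r : R, limn_einf (f \o u) <= r%:E & r%:E < f x.
  move: lfx; case: (limn_einf _) => [r| |] //.
  - by move=> rf; exists r.
  - by rewrite ltNge leey.
  - case: (f x) => [r| |] // _.
    + by exists (r - 1)%R; rewrite ?leNye// lte_fin gtrBl.
  by exists 0%R; rewrite ?leNye// ltry.
(* The eventual strict inequality [s < f (u n)] only passes to the lower limit as [s <=], so [s] has
   to lie strictly above [r]. *)
have [s rs sfx] : exists2 s : R, (r < s)%R & s%:E < f x.
  move: rfx; case: (f x) => [p| |] //.
    rewrite lte_fin => rp; exists ((r + p) / 2)%R; rewrite ?lte_fin; lra.
  by move=> _; exists (r + 1)%R; rewrite ?ltry// ltrDl.
have [V Vx hV] := lf _ _ sfx.
have : s%:E <= limn_einf (f \o u).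
  rewrite limn_einf_lim; apply: lime_ge; first exact: is_cvg_einfs.
  have [N _ hN] := ux _ Vx.
  exists N => // n Nn; apply: le_ereal_inf_tmp => _ [m /= nm <-].
  by apply/ltW/hV/hN; exact: leq_trans nm.
by move=> /le_trans /(_ lr); rewrite lee_fin leNgt rs.
Qed.

(** If it failed at [x0], there would be points [u k] tending to [x0] with integrals at most [a];
    Fatou's lemma along them contradicts that the integral at [x0] exceeds [a]. *)
Lemma lsc_integral (X : pseudoMetricType R) (h : X * R -> \bar R) :
  lower_semicontinuous h -> (forall z, 0 <= h z) ->
  lower_semicontinuous (fun x => \int[leb]_t h (x, t)).
Proof.
move=> lh h0 x0 a ax0; apply: contrapT => nV.
have mh x : measurable_fun setT (fun t => h (x, t)).
  by apply: lower_semicontinuous_measurable; exact: lsc_section.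
have seq k : exists x, ball x0 k.+1%:R^-1 x /\ \int[leb]_t h (x, t) <= a%:E.
  apply: contrapT => nx; apply: nV; exists (ball x0 k.+1%:R^-1).
    exact: nbhsx_ballx.
  by move=> y By; rewrite ltNge; apply/negP => ya; apply: nx; exists y.
have {}[u u_] := choice seq.
have := @fatou _ _ _ leb setT measurableT (fun k t => h (u k, t))
  (fun k => mh (u k)) (fun k t _ => h0 _).
apply/negP; rewrite -ltNge.
have le1 : limn_einf (fun k => \int[leb]_t h (u k, t)) <= a%:E.
  rewrite limn_einf_lim; apply: lime_le; first exact: is_cvg_einfs.
  apply: nearW => n; apply: (@le_trans _ _ (\int[leb]_t h (u n, t))).
    by apply: ereal_inf_lbound; exists n => //=.
  exact: (u_ n).2.
apply: le_lt_trans le1 _; apply: lt_le_trans ax0 _.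
apply: ge0_le_integral => //.
- exact: mh.
- apply: (emeasurable_fun_cvg (fun n t => einfs (fun k => h (u k, t)) n)).
    by move=> n; apply: measurable_fun_einfs => k; exact: mh.
  by move=> t _; rewrite limn_einf_lim; exact: is_cvg_einfs.
- move=> t _.
  apply: (@lsc_le_limn_einf _ (fun x => h (x, t)) u x0).
    apply: (lsc_comp (g := fun x => (x, t)) _ lh).
    by apply: continuous_pair => s; [exact: cvg_id|exact: cvg_cst].
  apply/cvg_ballP => e e0; near=> k.
  apply: (@le_ball _ _ _ k.+1%:R^-1); last exact: (u_ k).1.
  by apply/ltW; near: k; exact: (near_infty_natSinv_lt (PosNum e0)).
Unshelve. all: by end_near. Qed.

Lemma integral_lebesgue_shift (f : R -> \bar R) (a : R) :
  measurable_fun setT f -> (forall t, 0 <= f t) ->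
  \int[leb]_t f (t - a)%R = \int[leb]_t f t.
Proof.
move=> mf f0.
pose g : R -> measurableTypeR R := shift (- a)%R.
have mg : measurable_fun setT g by apply: measurable_funD.
have H A : measurable A -> leb A = pushforward leb g A.
  apply: lebesgue_measure_unique => // _ [[c b]] _ <-.
  rewrite /= /pushforward /=.
  rewrite (_ : _ @^-1` _ = `](c + a)%R, (b + a)%R]%classic); last first.
    by apply/seteqP; split=> t /=; rewrite !in_itv /= /g /shift; lra.
  rewrite !lebesgue_measure_itv /= !lte_fin ltrD2r.
  by case: ifP => // _; rewrite -!EFinB; congr EFin; lra.
transitivity (\int[pushforward leb g]_t f t).
  by rewrite ge0_integral_pushforward.
by apply: eq_measure_integral => A mA _; exact: esym (H A mA).
Qed.

End LowerSemicontinuous.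

Section IteratedIntegral.
Context {R : realType}.
Local Open Scope ereal_scope.
Local Notation leb := (@lebesgue_measure R).
Implicit Types n : nat.

Definition cons_mx n (t : R) (y : 'rV[R]_n) : 'rV[R]_n.+1 :=
  row_mx (t%:M : 'rV[R]_1) y.

Lemma cons_mx0 n t (y : 'rV[R]_n) : cons_mx t y 0%R ord0 = t.
Proof.
rewrite /cons_mx (_ : ord0 = lshift n (ord0 : 'I_1)); last exact/val_inj.
by rewrite (@row_mxEl _ 1 1 n) mxE eqxx mulr1n.
Qed.

Lemma cons_mxS n t (y : 'rV[R]_n) i : cons_mx t y 0%R (lift ord0 i) = y 0%R i.
Proof.
rewrite /cons_mx (_ : lift ord0 i = rshift 1 i); last exact/val_inj.
by rewrite (@row_mxEr _ 1 1 n).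
Qed.

Lemma cons_mx_eta n (y : 'rV[R]_n.+1) :
  cons_mx (y 0%R ord0) (\row_i y 0%R (lift ord0 i)) = y.
Proof.
apply/rowP => i; case: (unliftP ord0 i) => [j ->|->].
  by rewrite cons_mxS mxE.
by rewrite cons_mx0.
Qed.

Lemma cons_mxB n t s (y z : 'rV[R]_n) :
  (cons_mx t y - cons_mx s z)%R = cons_mx (t - s) (y - z).
Proof.
apply/rowP => i; case: (unliftP ord0 i) => [j ->|->].
  by rewrite [LHS]mxE [X in (_ + X)%R]mxE !cons_mxS !mxE.
by rewrite [LHS]mxE [X in (_ + X)%R]mxE !cons_mx0.
Qed.

Lemma continuous_cons_mx n :
  continuous (fun z : R * 'rV[R]_n => cons_mx z.1 z.2).
Proof.
move=> [t y]; apply/cvg_ballP => e e0; near=> z.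
have [z1 [_ z2]] : ball t e z.1 /\ ball y e z.2.
  split; near: z.
    by apply: (cvg_fst (nbhsx_ballx t e e0)) => /=.
  by apply: (cvg_snd (nbhsx_ballx y e e0)) => /=.
split=> // i j; rewrite (ord1 i).
by case: (unliftP ord0 j) => [k ->|->]; rewrite ?cons_mxS ?cons_mx0.
Unshelve. all: by end_near. Qed.

Lemma leb_integralS n (f : 'rV[R]_n.+1 -> \bar R) :
  leb_integral f = \int[leb]_t leb_integral (fun y => f (cons_mx t y)).
Proof. by []. Qed.

Lemma leb_integral_ge0 n (f : 'rV[R]_n -> \bar R) :
  (forall y, 0 <= f y) -> 0 <= leb_integral f.
Proof.
elim: n f => [f f0|n IH f f0]; first exact: f0.
by apply: integral_ge0 => t _; exact: IH.
Qed.

(** The parameter space [X] is general because the induction moves one integration variable into it: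
    [X] becomes [X * R]. *)
Lemma lsc_leb_integral n (X : pseudoMetricType R)
    (f : X * 'rV[R]_n -> \bar R) :
  lower_semicontinuous f -> (forall z, 0 <= f z) ->
  lower_semicontinuous (fun x => leb_integral (fun y => f (x, y))).
Proof.
elim: n X f => [|n IH] X f lf f0 /=.
  apply: (lsc_comp (g := fun x : X => (x, 0%R : 'rV[R]_0)) _ lf).
  by apply: continuous_pair => x; [exact: cvg_id|exact: cvg_cst].
pose g (z : (X * R) * 'rV[R]_n) := f (z.1.1, cons_mx z.1.2 z.2).
have lg : lower_semicontinuous g.
  apply: (lsc_comp (g := fun z : (X * R) * 'rV[R]_n =>
    (z.1.1, cons_mx z.1.2 z.2)) _ lf).
  apply: continuous_pair.
    exact: continuous_compT (@continuous_fst _ _) (@continuous_fst _ _).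
  apply: (continuous_compT (f := fun z : (X * R) * 'rV[R]_n => (z.1.2, z.2))
    _ (@continuous_cons_mx n)).
  apply: continuous_pair; last exact: continuous_snd.
  exact: continuous_compT (@continuous_fst _ _) (@continuous_snd _ _).
apply: (lsc_integral (h := fun z => leb_integral (fun y => g (z, y)))).
  by apply: IH => // z; exact: f0.
by move=> z; apply: leb_integral_ge0 => y; exact: f0.
Qed.

Lemma lsc_partial_integral n (f : 'rV[R]_n.+1 -> \bar R) :
  lower_semicontinuous f -> (forall z, 0 <= f z) ->
  lower_semicontinuous (fun t : R => leb_integral (fun y => f (cons_mx t y))).
Proof.
move=> lf f0; apply: (@lsc_leb_integral _ _ (fun z => f (cons_mx z.1 z.2))) =>
  //.
apply: (lsc_comp (g := fun z : R * 'rV[R]_n => cons_mx z.1 z.2) _ lf).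
exact: continuous_cons_mx.
Qed.

Lemma measurable_partial_integral n (f : 'rV[R]_n.+1 -> \bar R) :
  lower_semicontinuous f -> (forall z, 0 <= f z) ->
  measurable_fun setT
    ((fun t => leb_integral (fun y => f (cons_mx t y))) : R -> \bar R).
Proof.
move=> lf f0; apply: lower_semicontinuous_measurable.
exact: lsc_partial_integral.
Qed.

Lemma lsc_cons_mx n (f : 'rV[R]_n.+1 -> \bar R) t :
  lower_semicontinuous f -> lower_semicontinuous (fun y => f (cons_mx t y)).
Proof.
move=> lf; apply: (lsc_comp (g := cons_mx t) _ lf).
apply: (continuous_compT (f := fun y => (t, y)) _ (@continuous_cons_mx n)).
by apply: continuous_pair => y; [exact: cst_continuous|exact: cvg_id].
Qed.

Lemma leb_integral_shift n (f : 'rV[R]_n -> \bar R) a :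
  lower_semicontinuous f -> (forall y, 0 <= f y) ->
  leb_integral (fun y => f (y - a)%R) = leb_integral f.
Proof.
elim: n f a => [f a lf f0 /=|n IH f a lf f0].
  by congr f; apply/rowP => i; case: i.
rewrite !leb_integralS -[RHS](integral_lebesgue_shift (a 0%R ord0)).
- apply: eq_integral => t _.
  rewrite -[RHS](IH _ (\row_i a 0%R (lift ord0 i))) //; last exact: lsc_cons_mx.
  by congr leb_integral; apply/funext => y;
    rewrite -{1}(cons_mx_eta a) cons_mxB.
- exact: measurable_partial_integral.
- by move=> t; exact: leb_integral_ge0.
Qed.

(** The inner integral is positive at the first coordinate of [y0], hence by semicontinuity above
    some [r > 0] on an interval around it. This gives nonempty open sets a positive volume. *)
Lemma leb_integral_gt0 n (f : 'rV[R]_n -> \bar R) y0 :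
  lower_semicontinuous f -> (forall y, 0 <= f y) -> 0 < f y0 ->
  0 < leb_integral f.
Proof.
elim: n f y0 => [f y0 lf f0 /=|n IH f y0 lf f0 fy0].
  by rewrite (_ : 0%R = y0) //; apply/rowP => i; case: i.
rewrite leb_integralS; set g := fun t => _.
have lg : lower_semicontinuous g by exact: lsc_partial_integral.
have g0 t : 0 <= g t by exact: leb_integral_ge0.
have gt0 : 0 < g (y0 0%R ord0).
  apply: (IH _ (\row_i y0 0%R (lift ord0 i))) => //;
    last by rewrite cons_mx_eta.
  exact: lsc_cons_mx.
have [r r0 rg] : exists2 r : R, (0 < r)%R & r%:E < g (y0 0%R ord0).
  move: gt0; case: (g _) => [r| |] //.
    by rewrite lte_fin => r0; exists (r / 2)%R; rewrite ?lte_fin; lra.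
  by move=> _; exists 1%R; rewrite ?ltry.
have [V Vt hV] := lg _ _ rg.
have [e /= e0 eV] := Vt; set t0 := y0 0%R ord0 in eV.
pose I : set R := `](t0 - e)%R, (t0 + e)%R[%classic.
have IV t : I t -> V t.
  rewrite /I /= in_itv /= => tI; apply: eV => /=.
  by rewrite ltr_norml; lra.
have mI : measurable I by exact: measurable_itv.
have lI : leb I = (e + e)%:E.
  rewrite /I lebesgue_measure_itv /= lte_fin ifT; last by lra.
  by rewrite -EFinB; congr EFin; lra.
apply: (@lt_le_trans _ _ (\int[leb]_(t in I) cst r%:E t)).
  by rewrite integral_cst // [X in _ < _ * X]lI -EFinM lte_fin mulr_gt0 //
    addr_gt0.
rewrite integral_mkcond; apply: ge0_le_integral => //.
- by move=> t _; rewrite patchE; case: ifP => //; rewrite lee_fin ltW.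
- by apply/(measurable_restrictT _ _).1.
- exact: lower_semicontinuous_measurable.
- move=> t _; rewrite patchE; case: ifP => [|_]; last exact: g0.
  by move=> /set_mem/IV/hV/ltW.
Qed.

End IteratedIntegral.

Section BoundedLsc.
Context {R : realType}.
Local Open Scope ereal_scope.
Local Notation leb := (@lebesgue_measure R).

(** A single [K] bounds the values and the support (a cube), so that fixing a coordinate preserves
    the property with the same constant. *)
Definition bounded_lsc n (K : R) (f : 'rV[R]_n -> \bar R) :=
  [/\ lower_semicontinuous f, forall y, 0 <= f y <= K%:E &
      forall y, f y != 0 -> forall i, (`|y 0%R i| <= K)%R].

Lemma bounded_lsc_ge0 n K (f : 'rV[R]_n -> \bar R) :
  bounded_lsc K f -> forall y, 0 <= f y.
Proof. by move=> [_ f0 _] y; case/andP: (f0 y). Qed.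

Lemma bounded_lsc_cons_mx n K (f : 'rV[R]_n.+1 -> \bar R) t :
  bounded_lsc K f -> bounded_lsc K (fun y => f (cons_mx t y)).
Proof.
move=> [lf fK fs]; split=> //; first exact: lsc_cons_mx.
by move=> y fy i; rewrite -(cons_mxS t y); exact: fs.
Qed.

Lemma leb_integral_bounded n K (f : 'rV[R]_n -> \bar R) : (0 <= K)%R ->
  bounded_lsc K f -> leb_integral f <= (K * (K + K) ^+ n)%:E.
Proof.
move=> K0; elim: n f => [f [_ fK _]|n IH f bf].
  by rewrite expr0 mulr1; case/andP: (fK 0%R).
have f0 := bounded_lsc_ge0 bf; have [lf fK fs] := bf.
rewrite leb_integralS; set g := fun t => _.
pose I : set R := `[(- K)%R, K]%classic.
have mI : measurable I by exact: measurable_itv.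
have lI : leb I = (K + K)%:E.
  rewrite /I lebesgue_measure_itv /= lte_fin; case: ifP => KK.
    by rewrite -EFinB opprK.
  by congr EFin; lra.
apply: (@le_trans _ _ (\int[leb]_(t in I) cst (K * (K + K) ^+ n)%:E t)).
  rewrite [leRHS]integral_mkcond; apply: ge0_le_integral => //.
  - by move=> t _; exact: leb_integral_ge0.
  - exact: measurable_partial_integral.
  - by apply/(measurable_restrictT _ _).1.
  - move=> t _; rewrite patchE; case: ifPn => [_|tI].
      by apply: IH; exact: bounded_lsc_cons_mx.
    (* For [t] outside [[-K, K]] the slice is identically zero, and so is its iterated integral. *)
    rewrite /g (_ : (fun y => _) = cst 0).
      elim: (n) => [//|m IHm]; rewrite leb_integralS.
      by rewrite integral0_eq // => s _; apply/le_anti;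
        rewrite IHm leb_integral_ge0.
    apply/funext => y; apply/eqP; apply: contraNT tI => /fs /(_ ord0).
    by rewrite cons_mx0 ler_norml => tK; apply/mem_set; rewrite /I /= in_itv.
by rewrite integral_cst // [X in _ * X]lI -EFinM exprSr mulrA.
Qed.

Lemma integrable_partial_integral n K (f : 'rV[R]_n.+1 -> \bar R) :
  (0 <= K)%R -> bounded_lsc K f ->
  leb.-integrable setT (fun t => leb_integral (fun y => f (cons_mx t y))).
Proof.
move=> K0 bf; have f0 := bounded_lsc_ge0 bf; have [lf fK fs] := bf.
apply/integrableP; split; first exact: measurable_partial_integral.
under eq_integral do rewrite gee0_abs ?leb_integral_ge0 //.
apply: le_lt_trans (leb_integral_bounded K0 bf) _.
by rewrite ltry.
Qed.

(** The form [f - c * g] is what the center of mass calls for: its signed integrand is such a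
    combination of two nonnegative lower semicontinuous functions. *)
Lemma leb_integralBZ n K c (f g : 'rV[R]_n -> \bar R) : (0 <= K)%R ->
  bounded_lsc K f -> bounded_lsc K g ->
  leb_integral (fun y => f y - c%:E * g y) =
  leb_integral f - c%:E * leb_integral g.
Proof.
move=> K0; elim: n f g => [//|n IH] f g bf bg.
rewrite !leb_integralS.
transitivity (\int[leb]_t (leb_integral (fun y => f (cons_mx t y)) -
    c%:E * leb_integral (fun y => g (cons_mx t y)))).
  by apply: eq_integral => t _; apply: IH; exact: bounded_lsc_cons_mx.
have If := integrable_partial_integral K0 bf.
have Ig := integrable_partial_integral K0 bg.
rewrite integralB //; last exact: integrableZl.
by rewrite integralZl.
Qed.

End BoundedLsc.

(** * Translation equivariance of the center of mass *)

Section Centroid.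
Context {R : realType} {d : nat}.
Local Notation rV := 'rV[R]_d.
Implicit Types (s : set rV) (x t : rV).

Lemma shift_setE t s x : shift_set t s x <-> s (x - t).
Proof.
split=> [[y sy <-]|sx]; first by rewrite addrK.
by exists (x - t) => //; rewrite subrK.
Qed.

Lemma lsc_indic_affine s (g : rV -> R) : open s -> continuous g ->
  (forall y, s y -> 0 <= g y) ->
  lower_semicontinuous (fun y => (g y * \1_s y)%:E).
Proof.
move=> os cg g0; apply/lower_semicontinuousP => a.
have [a0|a0] := ltP a 0.
  rewrite (_ : [set x | _] = setT); first exact: openT.
  apply/seteqP; split=> // x _ /=; rewrite lte_fin indicE.
  by case: (boolP (x \in s)) => [/set_mem/g0|_];
    rewrite ?mulr1 ?mulr0//; apply: lt_le_trans.
rewrite (_ : [set x | _] = s `&` g @^-1` [set r | a < r]).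
  by apply: openI => //; apply: open_comp => // x _; exact: cg.
apply/seteqP; split=> x /=; rewrite lte_fin indicE.
  case: (boolP (x \in s)) => [/set_mem sx|_]; first by rewrite mulr1.
  by rewrite mulr0 => /(le_lt_trans a0); rewrite ltxx.
by move=> [sx ax]; rewrite mem_set // mulr1.
Qed.

Lemma coord_le_norm (y : rV) k : `|y 0 k| <= `|y|.
Proof.
rewrite [leRHS]/Num.Def.normr /= mx_normrE.
by apply: (le_bigmax _ (fun ij : 'I_1 * 'I_d => `|y ij.1 ij.2|) (0, k)).
Qed.

Lemma bounded_lsc_indic s C (g : rV -> R) : open s -> continuous g ->
  (forall y, s y -> 0 <= g y <= C) -> (forall y, s y -> `|y| <= C) -> 0 <= C ->
  bounded_lsc C (fun y => (g y * \1_s y)%:E).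
Proof.
move=> os cg g0 sC C0; split.
- by apply: lsc_indic_affine => // y /g0 /andP[].
- move=> y; rewrite !lee_fin indicE;
  case: (boolP (y \in s)) => [/set_mem /g0|_].
    by rewrite mulr1.
  by rewrite mulr0 lexx.
- move=> y; rewrite indicE; case: (boolP (y \in s)) => [/set_mem/sC yC _ i|_].
    by apply: le_trans yC; exact: coord_le_norm.
  by rewrite mulr0 eqxx.
Qed.

Lemma bounded_lsc_shift K t (f : rV -> \bar R) :
  bounded_lsc K f -> bounded_lsc (K + `|t|) (fun y => f (y - t)).
Proof.
move=> [lf fK fs]; split.
- apply: (lsc_comp (g := fun y : rV => (y - t : rV)) _ lf) => y.
  exact: (cvgB cvg_id (cvg_cst t)).
- move=> y; have /andP[-> /le_trans ->] := fK (y - t) => //.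
  by rewrite lee_fin lerDl.
- move=> y /fs yK i; have := yK i; have := coord_le_norm t i.
  rewrite !mxE => ti yi; rewrite -[y 0 i](subrK (t 0 i)).
  by apply: le_trans (ler_normD _ _) _; rewrite lerD.
Qed.

Lemma continuous_coord (k : 'I_d) : continuous (fun y : rV => y 0 k).
Proof. exact: coord_continuous. Qed.

Lemma centroid_shift s t : open s -> s !=set0 -> bounded_set s ->
  centroid (shift_set t s) = centroid s + t.
Proof.
move=> os [x0 sx0] [M [_ bM]].
pose B : R := `|M| + 1.
have sB y : s y -> `|y| <= B.
  by move=> sy; apply: (bM B) => //; rewrite /B; have := ler_norm M; lra.
pose C : R := B + `|t| + 1.
have B0 : 0 < B by rewrite /B; have := normr_ge0 M; lra.
have t0 := normr_ge0 t.
have C1 : 1 <= C by rewrite /C; lra.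
have C0 : 0 <= C by lra.
have indS y : \1_(shift_set t s) y = \1_s (y - t) :> R.
  rewrite !indicE; congr ((_ : bool)%:R).
  by apply/idP/idP => /set_mem H; apply/mem_set; apply/shift_setE.
pose one (y : rV) : \bar R := (1 * \1_s y)%:E.
have oneE y : one y = (\1_s y)%:E by rewrite /one mul1r.
have bone : bounded_lsc (C + C) one.
  apply: bounded_lsc_indic => //.
  - by move=> y; exact: cst_continuous.
  - by move=> y _; lra.
  - by move=> y /sB; rewrite /C; lra.
  - by lra.
apply/rowP => k; rewrite /centroid !mxE.
(* Adding [C] makes the coordinate nonnegative on [s]; the integrand of the center of mass is
   [f - C * one], and for the shifted set it is [f - (C - t 0 k) * one] composed with the shift. *)
pose f (y : rV) : \bar R := ((y 0 k + C) * \1_s y)%:E.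
have bf : bounded_lsc (C + C) f.
  apply: bounded_lsc_indic => //.
  - move=> y; exact: (cvgD (@continuous_coord k y) (cvg_cst C)).
  - move=> y /sB yB; have := le_trans (coord_le_norm y k) yB.
    by rewrite ler_norml /C; lra.
  - by move=> y /sB; rewrite /C; lra.
  - by lra.
have bfin (h : rV -> \bar R) : bounded_lsc (C + C) h -> leb_integral h \is a
  fin_num.
  move=> bh; rewrite ge0_fin_numE; last first.
    by apply: leb_integral_ge0; exact: bounded_lsc_ge0 bh.
  by apply: le_lt_trans (leb_integral_bounded _ bh) _; rewrite ?ltry; lra.
have V0 : (0 < leb_integral one)%E.
  apply: (leb_integral_gt0 (y0 := x0));
    [by case: bone|exact: bounded_lsc_ge0 bone|].
  by rewrite oneE indicE mem_set.
have Vfin := bfin _ bone; have Ffin := bfin _ bf.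
have volE : vol s = leb_integral one.
  by congr leb_integral; apply/funext => y; rewrite oneE.
have volS : vol (shift_set t s) = leb_integral one.
  rewrite -(leb_integral_shift t); [|by case: bone|exact: bounded_lsc_ge0 bone].
  by congr leb_integral; apply/funext => y; rewrite oneE indS.
rewrite volS volE.
have -> : (fun x : rV => (x 0 k * \1_s x)%:E) = (fun x => f x - C%:E * one x)%E.
  by apply/funext => y; rewrite /f /one -EFinM -EFinB; congr EFin; ring.
rewrite (leb_integralBZ (K := C + C)) //; last by lra.
have -> : (fun x : rV => (x 0 k * \1_(shift_set t s) x)%:E) =
    (fun x => f (x - t)%R - (C - t 0 k)%:E * one (x - t)%R)%E.
  apply/funext => y; rewrite /f /one indS -EFinM -EFinB; congr EFin.
  by rewrite !mxE; ring.
have Ct0 : 0 <= C + C + `|t| by lra.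
rewrite (leb_integralBZ _ Ct0); [|exact: bounded_lsc_shift..].
rewrite !leb_integral_shift; [|by case: bone|exact: bounded_lsc_ge0 bone|
  by case: bf|exact: bounded_lsc_ge0 bf].
move: V0; rewrite -(fineK Vfin) -(fineK Ffin) lte_fin => V0.
rewrite -!EFinM -!EFinB /= .
by field; rewrite gt_eqF.
Qed.

End Centroid.

(** * The hull of a multiset *)

Section EuclideanNorm.
Context {R : realType} {d : nat}.
Local Notation rV := 'rV[R]_d.
Implicit Types (x y : rV).

Lemma normr_le_enorm x : `|x| <= enorm x.
Proof.
rewrite [leLHS]/Num.Def.normr /= mx_normrE; apply: bigmax_le => [|[i k] _].
  exact: enorm_ge0.
rewrite /= -sqrtr_sqr ler_sqrt ?dotp_ge0 // (ord1 i) /dotp (bigD1 k) //= -expr2.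
by rewrite lerDl; apply: sumr_ge0 => j _; rewrite -expr2 sqr_ge0.
Qed.

Lemma enorm_le_normr x : enorm x <= d%:R * `|x|.
Proof.
rewrite -[leRHS]ger0_norm ?mulr_ge0 // -sqrtr_sqr ler_sqrt ?sqr_ge0 //.
apply: (@le_trans _ _ (\sum_(i < d) `|x| ^+ 2)).
  apply: ler_sum => i _; rewrite -expr2 -real_normK ?num_real //.
  by rewrite lerXn2r ?nnegrE // coord_le_norm.
rewrite sumr_const card_ord exprMn -[leLHS]mulr_natl ler_wpM2r ?sqr_ge0 //.
by rewrite -natrX ler_nat -mulnn; case: d => // n; exact: leq_pmulr.
Qed.

Lemma enormB x y : enorm (x - y) = enorm (y - x).
Proof. by rewrite -enormN opprB. Qed.

Lemma enorm_le_sub x y z : enorm (x - z) <= enorm (x - y) + enorm (y - z).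
Proof. by rewrite -[x - z](subrKA y) enormD. Qed.

Lemma enormZ (a : R) x : enorm (a *: x) = `|a| * enorm x.
Proof.
rewrite /enorm dotpZl dotpC dotpZl mulrA -expr2 sqrtrM ?sqr_ge0 //.
by rewrite sqrtr_sqr.
Qed.

Lemma enorm_eq0 x : enorm x = 0 -> x = 0.
Proof.
by move=> x0; apply/eqP; rewrite -normr_le0; have := normr_le_enorm x;
  rewrite x0.
Qed.

Lemma continuous_enorm : continuous (fun x : rV => enorm x).
Proof.
move=> x A /nbhs_ballP[e /= e0 eA].
apply/(@nbhs_ballP R); exists (e / d.+1%:R) => /=; first by rewrite divr_gt0.
move=> y; rewrite -ball_normE /= => yx; apply: eA.
have xy : enorm (x - y) < e.
  apply: le_lt_trans (enorm_le_normr _) _.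
  apply: (@le_lt_trans _ _ (d.+1%:R * `|x - y|)).
    by rewrite ler_wpM2r // ler_nat.
  by rewrite -ltr_pdivlMl // mulrC.
have := enorm_le_sub x y 0; have := enorm_le_sub y x 0.
by rewrite /ball /= !subr0 (enormB y x) ltr_norml; lra.
Qed.

End EuclideanNorm.

Section Hull.
Context {R : realType} {d : nat} {I : Type}.
Local Notation rV := 'rV[R]_d.
Local Notation mset := (multiset R d I).
Implicit Types (Lam L : mset) (x y p t : rV) (r e : R).

Lemma in_bstar0 r x (i : I) : bstar r 0 (x, i) <-> enorm x <= r.
Proof. by rewrite /bstar /cball /= subr0. Qed.

(** The two small shifts allowed by [dstar_set] are absorbed into the translation [t], which makes
    the agreement exact. *)
Lemma hull_local Lam L r : hull Lam L ->
  exists t, bstar r 0 `&` L = bstar r 0 `&` phi t Lam.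
Proof.
(* With this [e] the cap [(Num.sqrt 2)^-1] of the distance exceeds [e], and any [a < e] satisfies
   [r + a <= a^-1], which leaves room to undo the shift [x]. *)
move=> hL; pose e : R := (Num.max r 0 + 2)^-1.
have m0 : 0 <= Num.max r 0 by rewrite le_max lexx orbT.
have mr : r <= Num.max r 0 by rewrite le_max lexx.
have e0 : 0 < e by rewrite invr_gt0; lra.
have [_ [[t _ <-]]] := hL _ (nbhsx_ballx L e e0).
move=> /mset_dist_lt [|[a ae [a0 [x [y [xa ya E]]]]]].
  rewrite ltf_pV2 ?posrE ?sqrtr_gt0 //; last lra.
  move=> H; have := @sqr_sqrtr R 2 ltac:(lra); rewrite expr2.
  set s := Num.sqrt 2 in H *; nra.
have ra : r + a <= a^-1.
  have e1 : e <= 1 by rewrite /e invf_le1; lra.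
  have : e^-1 < a^-1 by rewrite ltf_pV2 ?posrE.
  rewrite [X in X < _]invrK; lra.
move: xa; rewrite /cball /= subr0 => xa.
exists (- x + y + t); have := @mset_dist_shrink _ _ _ _ _ _ r (- x) _ E.
by rewrite !phi_phi addNr phi0; apply; rewrite enormN; lra.
Qed.

Lemma hull_of_local Lam L :
  (forall r, exists t, bstar r 0 `&` L = bstar r 0 `&` phi t Lam) -> hull Lam L.
Proof.
move=> hL B /nbhs_ballP [e /= e0 eB].
have [t E] := hL (e / 2)^-1; exists (phi t Lam); split; first by exists t.
apply: eB; apply/mset_dist_lt; right; exists (e / 2); first lra.
split; first lra.
by exists 0, 0; rewrite !phi0; split => //; rewrite /cball /= subr0 enorm0; lra.
Qed.

Lemma hull_phi Lam L p : hull Lam L -> hull Lam (phi p L).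
Proof.
move=> hL; apply: hull_of_local => r.
have [t E] := hull_local (r + enorm p) hL; exists (p + t).
by rewrite -phi_phi; apply: mset_dist_shrink E; rewrite addrC.
Qed.

Lemma hull_self_phi Lam t : hull Lam (phi t Lam).
Proof. by apply: hull_of_local => r; exists t. Qed.

Lemma bstar_supp r L L' x i : bstar r 0 `&` L = bstar r 0 `&` L' ->
  enorm x <= r -> L (x, i) -> L' (x, i).
Proof.
move=> /seteqP[LL' _] xr Lx.
by have [|] := LL' (x, i); first by split=> //; apply/in_bstar0.
Qed.

Lemma bstar_sub r r' L L' : r' <= r -> bstar r 0 `&` L = bstar r 0 `&` L' ->
  bstar r' 0 `&` L = bstar r' 0 `&` L'.
Proof.
move=> r'r E; rewrite -[L]phi0 -[L']phi0.
by apply: mset_dist_shrink E; rewrite enorm0 add0r.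
Qed.

Definition separated L r0 := forall x y, supp L x -> supp L y ->
  enorm (x - y) <= r0 -> x = y.

Lemma uniformly_discrete_separated L : uniformly_discrete (supp L) ->
  exists2 r0, 0 < r0 & separated L r0.
Proof.
move=> [r r0 ud]; exists r => // x y Lx Ly xy.
apply: (ud y) => //; split=> //; rewrite /cball /= ?subrr ?enorm0 //;
  exact: ltW.
Qed.

Lemma separated_hull Lam L r0 : separated Lam r0 -> hull Lam L ->
  separated L r0.
Proof.
move=> sep hL x y [i Lx] [j Ly] xy.
have [t E] := hull_local (Num.max (enorm x) (enorm y)) hL.
have /= Lamx := bstar_supp E _ Lx; have /= Lamy := bstar_supp E _ Ly.
apply: (addIr t); apply: sep; [exists i|exists j|].
- by apply: Lamx; rewrite le_max lexx.
- by apply: Lamy; rewrite le_max lexx orbT.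
- by rewrite opprD addrACA subrr addr0.
Qed.

Lemma transversal_local Lam L r : canonical_transversal Lam L ->
  exists2 p, supp Lam p & bstar r 0 `&` L = centered_cluster Lam r p.
Proof.
(* The radius [Num.max r 0] keeps the origin in the ball also for negative [r], so that [t] is a
   point of [Lam]. *)
move=> [hL [i L0]]; have [t E] := hull_local (Num.max r 0) hL; exists t.
  exists i; have := bstar_supp E _ L0; rewrite /phi /= add0r; apply.
  by rewrite enorm0 le_max lexx orbT.
by apply: bstar_sub E; rewrite le_max lexx.
Qed.

(* Two elements of the transversal that agree up to small shifts agree without
   shifts, since both have a point at the origin. *)
Lemma transversal_near Lam r0 e r L L' : separated Lam r0 ->
  0 < e -> e <= (Num.sqrt 2)^-1 -> e + e <= r0 -> r + e <= e^-1 ->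
  hull Lam L -> canonical_transversal Lam L' -> supp L 0 ->
  mset_dist L L' < e -> bstar r 0 `&` L = bstar r 0 `&` L'.
Proof.
move=> sep e0 es er re hL [hL' [j L'0]] [i L0].
move=> /mset_dist_lt [|[a ae [a0 [x [y [xa ya E]]]]]];
  first by rewrite ltNge es.
move: xa ya; rewrite /cball /= !subr0 => xa ya.
have a1 : e^-1 < a^-1 by rewrite ltf_pV2 ?posrE.
have s1 : (Num.sqrt 2)^-1 <= 1 :> R.
  rewrite invf_le1 ?sqrtr_gt0 // -[leLHS]sqrtr1 ler_sqrt //; lra.
have e1 : 1 <= e^-1 by rewrite -invr1 lef_pV2 ?posrE; lra.
(* The origin of [L] is seen at [- x] in [phi x L], hence also in [phi y L']. So [y - x] is a point
   of [L'] at distance at most [r0] from its point 0, and it must be 0. *)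
have Lx : phi y L' (- x, i).
  apply: (bstar_supp E); first by rewrite enormN; lra.
  by rewrite /phi /= addNr.
have xy : x = y.
  apply/eqP; rewrite eq_sym -subr_eq0; apply/eqP.
  apply: (separated_hull sep hL'); [by exists i; rewrite addrC|by exists j|].
  rewrite subr0; apply: le_trans (enormD _ _) _; rewrite enormN; lra.
have := @mset_dist_shrink _ _ _ _ _ _ r (- x) _ E.
by rewrite !phi_phi -xy addNr !phi0; apply; rewrite enormN; lra.
Qed.

End Hull.

(** * Displacement of a particle in a bounded number of collisions *)

Section Displacement.
Context {R : realType} {d : nat}.
Local Notation rV := 'rV[R]_d.
Implicit Types (s : set rV) (x y v p t : rV).

Lemma closure_normP (A : set rV) x :
  closure A x <-> forall e, 0 < e -> exists2 y, A y & `|x - y| < e.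
Proof.
split=> [cA e e0|H B /nbhs_ballP [e /= e0 eB]].
  have [y [Ay]] := cA _ (nbhsx_ballx x e e0).
  by rewrite -ball_normE /= => xy; exists y.
by have [y Ay xy] := H e e0; exists y; split=> //; apply: eB;
  rewrite -ball_normE.
Qed.

Lemma shift_setK t s : shift_set (- t) (shift_set t s) = s.
Proof.
apply/seteqP; split=> x.
  by move=> /shift_setE/shift_setE; rewrite opprK addrK.
by move=> sx; apply/shift_setE/shift_setE; rewrite opprK addrK.
Qed.

Lemma closure_shift t s x : closure (shift_set t s) x <-> closure s (x - t).
Proof.
split=> /closure_normP H; apply/closure_normP => e /H [y].
  by move=> /shift_setE sy xy; exists (y - t) => //; rewrite opprB addrA subrK.
move=> sy xy; exists (y + t); first by apply/shift_setE; rewrite addrK.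
by rewrite opprD addrA addrAC.
Qed.

Lemma frontier_shift t s x : frontier (shift_set t s) x <-> frontier s (x - t).
Proof.
have C : ~` shift_set t s = shift_set t (~` s).
  apply/seteqP; split=> y /=.
    by move=> nsy; apply/shift_setE => sy; apply: nsy; apply/shift_setE.
  by move=> /shift_setE nsy /shift_setE.
rewrite /frontier C; by split=> -[/closure_shift ? /closure_shift ?].
Qed.

Lemma enorm_triD a b c (M N : R) : enorm (a - c :> rV) <= M ->
  enorm (b - c) <= N -> enorm (a - b) <= M + N.
Proof.
by move=> ac bc; apply: le_trans (enorm_le_sub _ c _) _; rewrite lerD // enormB.
Qed.

(* A line that starts at the boundary of an open set and enters it leaves it at
   some point of the boundary. *)
Lemma exit_point s c x v (B : R) : open s ->
  (forall y, s y -> enorm (y - c) <= B) -> frontier s x ->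
  enorm (x - c) <= B -> enorm v = 1 ->
  exists2 u0, 0 <= u0 <= B + B & T1plus s (x + u0 *: v, v).
Proof.
move=> os sB fx xB v1.
have B0 : 0 <= B by apply: le_trans xB; exact: enorm_ge0.
(* The times spent inside [s]. The exit time is 0 if there are none and [sup V] otherwise; [B + B]
   bounds it because [x] and all points of [s] are within [B] of [c]. *)
pose V := [set u : R | 0 <= u /\ s (x + u *: v)].
have [V0|nV] := pselect (V !=set0); last first.
  exists 0; first lra.
  rewrite scale0r addr0; split=> //=; exists 1 => // t /andP[t0 _] sx.
  by apply: nV; exists t; split=> //; exact: ltW.
have VB : ubound V (B + B).
  move=> u [u0 /sB su]; have -> : u = enorm (x + u *: v - x).
    by rewrite addrAC subrr add0r enormZ v1 mulr1 ger0_norm.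
  exact: enorm_triD su xB.
have hs : has_sup V by split=> //; exists (B + B).
have u0B : sup V <= B + B by exact: ge_sup.
have [u1 Vu1] := V0.
have u00 : 0 <= sup V by apply: le_trans (ub_le_sup hs.2 Vu1); case: Vu1.
have after (t : R) : sup V < t -> ~ s (x + t *: v).
  move=> ut st; have : V t by split=> //; apply: le_trans (ltW ut).
  by move=> /(ub_le_sup hs.2); rewrite leNgt ut.
exists (sup V); first by rewrite u00.
split=> //=; last first.
  exists 1 => // t /andP[t0 _]; rewrite -addrA -scalerDl; apply: after.
  by rewrite ltrDl.
split.
  apply/closure_normP => e e0; have [u Vu uV] := sup_adherent e0 hs.
  exists (x + u *: v); first by case: Vu.
  apply: le_lt_trans (normr_le_enorm _) _.
  rewrite opprD addrACA subrr add0r -scalerBl enormZ v1 mulr1 ger0_norm;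
    first lra.
  by rewrite subr_ge0; apply: ub_le_sup => //; exact: hs.2.
apply: subset_closure => su.
have /nbhs_ballP [e /= e0 es] := open_nbhs_nbhs (conj os su).
apply: (after (sup V + e / 2)); first lra.
apply: es; rewrite -ball_normE /=; apply: le_lt_trans (normr_le_enorm _) _.
rewrite opprD addrACA subrr add0r -scalerBl enormZ v1 mulr1 opprD addNKr.
by rewrite normrN ger0_norm; lra.
Qed.

End Displacement.

Lemma finite_uniform_bound (R : realType) (T : Type) (A : set T)
    (P : T -> R -> Prop) : finite_set A ->
  (forall a, A a -> exists b, forall b', b <= b' -> P a b') ->
  exists2 b, 0 < b & forall a, A a -> P a b.
Proof.
move=> fA H.
have H' a : exists b, A a -> forall b', b <= b' -> P a b'.
  by have [/H[b hb]|nA] := pselect (A a); [exists b|exists 0].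
have [f hf] := choice H'.
have /finite_seqP [s sE] := finite_image f fA.
exists (\big[Num.max/1]_(x <- s) x).
  by apply: (lt_le_trans ltr01); exact: bigmax_ge_id.
move=> a Aa; apply: hf => //; apply: le_bigmax_seq => //.
by have : (f @` A) (f a) by [exists a]; rewrite sE.
Qed.

Section Scatterers.
Context {R : realType} {d : nat}.
Local Notation rV := 'rV[R]_d.
Local Notation mset := (multiset R d (color R d)).
Variable S : set (set rV).
Hypothesis hS : scatterer_configuration S.

Lemma class_of_self s : S s -> class_of S s s.
Proof.
move=> Ss; split=> //; exists 0; apply/seteqP; split=> x.
  by move=> sx; apply/shift_setE; rewrite subr0.
by move=> /shift_setE; rewrite subr0.
Qed.

Lemma class_centroid s s' : S s -> class_of S s s' ->
  exists2 t, s' = shift_set t s & centroid s' = centroid s + t.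
Proof.
move=> Ss [_ [t ->]]; exists t => //.
have [_ /(_ s Ss) [os s0 _ bs _] _] := hS; exact: centroid_shift.
Qed.

(** [rep] is a union over the whole class; by [centroid_shift] all members of the class contribute
    the same set. *)
Lemma rep_class s : S s -> rep (class_of S s) = shift_set (- centroid s) s.
Proof.
move=> Ss; apply/seteqP; split=> x.
  move=> [s' /(class_centroid Ss) [t -> ->]] /shift_setE.
  by rewrite addrA addrK => sx; apply/shift_setE; rewrite opprK.
move=> /shift_setE; rewrite opprK => sx.
by exists s => //; exact: class_of_self.
Qed.

Lemma scatterers_bounded : finite_set (colors S) ->
  exists2 B : R, 0 < B & forall s, S s -> forall y, closure s y ->
    enorm (y - centroid s) <= B.
Proof.
move=> fC.
have [b b0 hb] : exists2 b : R, 0 < b & forall c, colors S c ->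
    forall s, c s -> forall y, s y -> enorm (y - centroid s) <= b.
  apply: finite_uniform_bound fC _ => _ [s Ss <-].
  have [_ /(_ s Ss) [_ _ _ [M [_ bM]] _] _] := hS.
  exists (d%:R * (`|M| + 1) + enorm (centroid s)) => b hb s'.
  move=> /(class_centroid Ss) [t -> ->] y /shift_setE sy.
  apply: le_trans hb; rewrite opprD addrA addrAC.
  apply: le_trans (enormD _ _) _; rewrite enormN lerD2r.
  apply: le_trans (enorm_le_normr _) _; rewrite ler_wpM2l //.
  by apply: (bM (`|M| + 1)) => //; have := ler_norm M; lra.
(* Passing to the closure costs 1 in the max norm, hence at most [d] in Euclidean length. *)
exists (d%:R + b); first by have : 0 <= d%:R :> R by []; lra.
move=> s Ss y /closure_normP /(_ 1 ltr01) [y' sy' yy'].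
rewrite -(subrKA y'); apply: le_trans (enormD _ _) _; apply: lerD.
  apply: le_trans (enorm_le_normr _) _.
  by rewrite -[leRHS]mulr1 ler_wpM2l // ltW.
by apply: (hb (class_of S s)) => //; [exists s|exact: class_of_self].
Qed.

End Scatterers.

Section Displacement.
Context {R : realType} {d : nat}.
Local Notation rV := 'rV[R]_d.
Local Notation mset := (multiset R d (color R d)).
Variable S : set (set rV).
Hypothesis hS : scatterer_configuration S.
Hypothesis fC : finite_set (colors S).
Hypothesis hhor : finite_horizon S.

(** The invariant carried along the iteration. It passes from one collision to the next without an
    argument that the reflected velocity is outgoing; [exit_point] makes up for that. *)
Definition particle_state (z : phase_space R d) : Prop :=
  [/\ hull (Lambda S) z.2, z.2 (0, z.1.1), frontier (rep z.1.1) z.1.2.1 &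
      enorm z.1.2.2 = 1].

Lemma reflect_vel_enorm (n v : rV) : enorm n = 1 ->
  enorm (reflect_vel n v) = enorm v.
Proof.
move=> n1; have nn : dotp n n = 1.
  by rewrite -[LHS]sqr_sqrtr ?dotp_ge0 // -/(enorm n) n1 expr1n.
rewrite /enorm /reflect_vel; congr Num.sqrt.
rewrite -scaleNr dotpDl dotpZl !(dotpC _ (_ + _)) !dotpDl !dotpZl nn (dotpC n
  v).
by ring.
Qed.

Lemma hull_color L q k : hull (Lambda S) L -> L (q, k) -> colors S k.
Proof.
move=> hL Lq; have [t E] := hull_local (enorm q) hL.
by have [s Ss [_ <-]] := bstar_supp E (lexx _) Lq; exists s.
Qed.

Lemma frontier_rep_bounded (B : R) k y :
  (forall s, S s -> forall y, closure s y -> enorm (y - centroid s) <= B) ->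
  colors S k -> frontier (rep k) y -> enorm y <= B.
Proof.
move=> sB [s Ss <-]; rewrite (rep_class hS Ss) => /frontier_shift [].
by rewrite opprK => /(sB _ Ss); rewrite addrK.
Qed.

(** The flight time is bounded by transfer to [S]: near the origin [L] is a translate of [Lambda S],
    the ray leaves the translated scatterer within time [B + B], and from there finite horizon
    produces an obstacle within time [M]. Carried back to [L], this obstacle would precede a later
    collision. *)
Lemma billiard_step_state : exists2 M1 : R, 0 <= M1 & forall z z',
  particle_state z -> billiard_step z z' ->
  particle_state z' /\ exists2 p, enorm p <= M1 & z'.2 = phi p z.2.
Proof.
have [B B0 sB] := scatterers_bounded hS fC.
have [M hM] := hhor.
(* A starting point within [B], a path of length at most [B + B + M] and a scatterer of radius [B]:
   [rho] bounds both the displacement and the center of the transferred obstacle. *)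
pose rho := 4 * B + `|M|.
have Mle := ler_norm M; have M0 := normr_ge0 M.
exists rho; first by rewrite /rho; lra.
move=> [[i [x v]] L] [[j [x' v']] L'] [/= hL L0 fx v1].
move=> [t [p [n [Ljp [_ _ t0 fy first] [n1 _] [-> -> ->]]]]].
have xB := frontier_rep_bounded sB (hull_color hL L0) fx.
have fy' : frontier (rep j) (x + t *: v - p) by exact/frontier_shift.
have yB := frontier_rep_bounded sB (hull_color hL Ljp) fy'.
have tM : t <= B + B + M.
  have [t1 E] := hull_local rho hL.
  have : phi t1 (Lambda S) (0, i).
    by apply: bstar_supp E _ L0; rewrite enorm0 /rho; lra.
  rewrite /phi /= add0r => -[s Ss [st1 iE]].
  have repi : rep i = shift_set (- t1) s by rewrite -iE (rep_class hS Ss) st1.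
  have fs : frontier s (x + t1).
    by move: fx; rewrite repi => /frontier_shift; rewrite opprK.
  have [u0 /andP[u00 u0B] out] : exists2 u0, 0 <= u0 <= B + B &
      T1plus s (x + t1 + u0 *: v, v).
    apply: (exit_point (c := centroid s)) => //.
    - by have [_ /(_ s Ss) []] := hS.
    - by move=> y sy; apply: sB => //; exact: subset_closure.
    - by apply: sB => //; case: fs.
  have [t2 [s' [[Ss' s's t20 fs' _] t2M]]] := hM _ _ _ Ss out.
  rewrite -addrA -scalerDl in fs'.
  pose q := centroid s' - t1.
  have s'y : closure s' (x + t1 + (u0 + t2) *: v) by case: fs'.
  have qB : enorm q <= rho.
    have -> : q = (x + (u0 + t2) *: v) -
        (x + t1 + (u0 + t2) *: v - centroid s').
      by apply/rowP => k; rewrite !mxE; ring.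
    apply: le_trans (enormD _ _) _; rewrite enormN.
    have := sB _ Ss' _ s'y; have := enormD x ((u0 + t2) *: v).
    rewrite enormZ v1 mulr1 ger0_norm ?addr_ge0 ?(ltW t20) //.
    by rewrite /rho; lra.
  have Lq : L (q, class_of S s').
    by apply: (bstar_supp (esym E) qB); rewrite /phi /= subrK; exists s'.
  have qE : shift_set q (rep (class_of S s')) = shift_set (- t1) s'.
    rewrite (rep_class hS Ss'); apply/seteqP; split=> y.
      move=> /shift_setE/shift_setE; rewrite /q opprB opprK => H.
      by apply/shift_setE; rewrite opprK; move: H; rewrite addrA subrK.
    move=> /shift_setE; rewrite opprK => H.
    by apply/shift_setE/shift_setE; rewrite /q opprB opprK addrA subrK.
  rewrite leNgt; apply/negP => tB.
  apply: (first (u0 + t2) (shift_set (- t1) s')).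
  - by apply/andP; split; lra.
  - by exists (q, class_of S s').
  - rewrite repi => /(congr1 (shift_set (- - t1))).
    by rewrite !shift_setK.
  - by apply/frontier_shift; rewrite opprK addrAC.
split; last first.
  exists p => //; have -> : p = (x + t *: v) - (x + t *: v - p).
    by rewrite opprB addrC subrK.
  apply: le_trans (enormD _ _) _; rewrite enormN.
  have := enormD x (t *: v); rewrite enormZ v1 mulr1 gtr0_norm //.
  by rewrite /rho; lra.
split=> //=; [exact: hull_phi|by rewrite /phi /= add0r|].
by rewrite reflect_vel_enorm.
Qed.

Lemma billiard_iter_displacement : exists2 M1 : R, 0 <= M1 & forall n z,
  particle_state z ->
  exists2 p, enorm p <= n%:R * M1 & (iter n (@billiard_map R d) z).2 = phi p
    z.2.
Proof.
have [M1 M10 hM1] := billiard_step_state; exists M1 => //.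
have step z : particle_state z -> particle_state (billiard_map z) /\
    exists2 p, enorm p <= M1 & (billiard_map z).2 = phi p z.2.
  (* If there is no successor, [billiard_map] returns [z] itself, with displacement 0. *)
  move=> zs; rewrite /billiard_map; case: xgetP => [z' _|_]; first exact: hM1.
  by split=> //; exists 0; rewrite ?enorm0 ?phi0.
move=> n z zs.
suff [_ []] : particle_state (iter n (@billiard_map R d) z) /\
    exists2 p, enorm p <= n%:R * M1 &
      (iter n (@billiard_map R d) z).2 = phi p z.2 by move=> p; exists p.
elim: n => [|n [IHs [p pM pE]]].
  by split=> //; exists 0; rewrite ?enorm0 ?mul0r ?phi0.
have [s' [q qM qE]] := step _ IHs; split=> //; exists (q + p).
  by rewrite mulrSr mulrDl mul1r addrC; apply: le_trans (enormD _ _) (lerD _ _).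
by rewrite iterS qE pE phi_phi.
Qed.

End Displacement.

(** * Counting points and clusters of a repetitive multiset *)

Lemma mem_fset_set_iff (T : choiceType) (A : set T) x :
  finite_set A -> (x \in fset_set A) <-> A x.
Proof. by move=> fA; rewrite in_fset_set // in_setE. Qed.

(** [f] embeds the product of [A] with [m] labels into [B]; the label 0 alone gives the finiteness
    of [A]. *)
Lemma count_mul_le (T U : choiceType) (A : set T) (B : set U) m
    (f : T -> nat -> U) : (0 < m)%N -> finite_set B ->
  (forall x j, A x -> (j < m)%N -> B (f x j)) ->
  (forall x x' j j', A x -> A x' -> (j < m)%N -> (j' < m)%N ->
     f x j = f x' j' -> x = x' /\ j = j') ->
  finite_set A /\ (count_set A * m <= count_set B)%N.
Proof.
move=> m0 fB fAB finj.
have fA : finite_set A.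
  have : finite_set ((f^~ 0%N) @` A).
    by apply: sub_finite_set fB => _ [x Ax <-]; exact: fAB.
  rewrite (eq_finite_set (inj_card_eq _)) // => x y /set_mem Ax /set_mem Ay.
  by move=> /finj [].
split=> //; rewrite /count_set.
set s := [seq f x j | x <- fset_set A, j <- iota 0 m].
have -> : (#|` fset_set A| * m)%N = size s by rewrite size_allpairs size_iota.
apply: uniq_leq_size.
  apply: allpairs_uniq; [exact: fset_uniq|exact: iota_uniq|].
  move=> y y' /allpairsP [[x j] /= [/mem_fset_set_iff Ax jm ->]].
  move=> /allpairsP [[x' j'] /= [/mem_fset_set_iff Ax' jm' ->]] /=.
  move: jm jm'; rewrite !mem_iota /= !add0n => jm jm' /finj.
  by move=> []; [exact: Ax|exact: Ax'|by []|by []|move=> -> ->].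
move=> y /allpairsP [[x j] /= [/mem_fset_set_iff Ax jm ->]].
apply/mem_fset_set_iff => //; apply: fAB; first exact: Ax.
by move: jm; rewrite mem_iota.
Qed.

Lemma count_inj_le (T U : choiceType) (A : set T) (B : set U) (f : T -> U) :
  finite_set B -> (forall x, A x -> B (f x)) ->
  (forall x x', A x -> A x' -> f x = f x' -> x = x') ->
  finite_set A /\ (count_set A <= count_set B)%N.
Proof.
move=> fB fAB finj.
rewrite -(muln1 (count_set A)).
apply: (count_mul_le (f := fun x _ => f x)) => // [x j Ax _|x x' j j' Ax Ax'].
  exact: fAB.
by case: j j' => [|//] [|//] _ _ /(finj _ _ Ax Ax').
Qed.

Lemma count_sub (T : choiceType) (A B : set T) :
  finite_set B -> A `<=` B -> (count_set A <= count_set B)%N.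
Proof. by move=> fB AB; have [] := count_inj_le (f := id) fB AB. Qed.

Lemma count_fin (U : finType) : (count_set [set: U] <= #|U|)%N.
Proof.
rewrite /count_set cardE; apply: uniq_leq_size => [|x _];
  first exact: fset_uniq.
by rewrite mem_enum.
Qed.

Section Counting.
Context {R : realType} {d : nat} {I : Type}.
Local Notation rV := 'rV[R]_d.
Local Notation mset := (multiset R d I).
Implicit Types (L : mset) (x y p t c : rV) (r e T : R).

Definition points L c T : set rV := supp L `&` cball c T.

Lemma separated_count L r0 : 0 < r0 -> separated L r0 ->
  exists2 C : R, 0 < C & forall c T, 0 <= T -> finite_set (points L c T) /\
    (count_set (points L c T))%:R <= C * (T + 1) ^+ d.
Proof.
(* Points are sorted into grid cells of side [h^-1 = r0 / d.+1]; the Euclidean diameter of a cell is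
   then at most [r0], so a cell holds at most one point. *)
move=> r00 sep; pose h : R := d.+1%:R / r0.
have h0 : 0 < h by rewrite divr_gt0.
exists ((h + h + 2) ^+ d); first by rewrite exprn_gt0 //; lra.
move=> c T T0; pose m := Num.truncn ((T + T) * h).
have Th : 0 <= (T + T) * h by rewrite mulr_ge0 //; lra.
pose f x : {ffun 'I_d -> 'I_m.+1} :=
  [ffun k => inord (Num.truncn ((x 0 k - c 0 k + T) * h))].
have box x k : points L c T x -> 0 <= (x 0 k - c 0 k + T) * h <= (T + T) * h.
  move=> [_ xc]; have := le_trans (normr_le_enorm _) xc.
  move=> /(le_trans (coord_le_norm _ k)); rewrite !mxE ler_norml => xk.
  by rewrite mulr_ge0 /= ?ler_pM2r //; lra.
have [|||fin le] := @count_inj_le _ _ (points L c T) [set: {ffun 'I_d ->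
  'I_m.+1}]
  f.
- exact: finite_finset.
- by [].
- move=> x x' Px Px' ff; apply: sep; [by case: Px|by case: Px'|].
  apply: le_trans (enorm_le_normr _) _.
  rewrite -[r0](@divfK _ d.+1%:R) // mulrC ler_pM // ?ler_nat //.
  rewrite [leLHS]/Num.Def.normr /= mx_normrE; apply: bigmax_le => [|[i k] _].
    by rewrite divr_ge0 // ltW.
  rewrite /= (ord1 i) !mxE.
  have /andP[b1 b2] := box x k Px; have /andP[b1' b2'] := box x' k Px'.
  have := congr1 (fun g : {ffun 'I_d -> 'I_m.+1} => val (g k)) ff.
  rewrite /f !ffunE /= !inordK ?ltnS; [|exact: le_truncn..] => E.
  have := truncn_itv b1; have := truncn_itv b1'; rewrite E => n1 n2.
  have : `|(x 0 k - x' 0 k) * h| <= 1.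
    rewrite (_ : _ * h = (x 0 k - c 0 k + T) * h - (x' 0 k - c 0 k + T) * h);
      last by ring.
    by move: n1 n2; rewrite -!natr1 ler_norml; lra.
  by rewrite normrM (gtr0_norm h0) -ler_pdivlMr // /h div1r invf_div.
split=> //; apply: (@le_trans _ _ (m.+1%:R ^+ d)).
  rewrite -natrX ler_nat; apply: leq_trans le _.
  by apply: leq_trans (count_fin _) _; rewrite card_ffun !card_ord.
rewrite -exprMn lerXn2r ?nnegrE //; first by rewrite mulr_ge0; lra.
have /andP[mT _] := truncn_itv Th; rewrite -natr1.
have hT : 0 <= h * T by rewrite mulr_ge0 // ltW.
move: mT; rewrite -/m mulrDl [T * h]mulrC; lra.
Qed.

End Counting.

Lemma natr_dist_ge1 (R : realType) (j k : nat) : j != k ->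
  1 <= `|j%:R - k%:R| :> R.
Proof.
rewrite neq_ltn => /orP[] jk; [rewrite distrC|];
  by apply: le_trans (ler_norm _); rewrite lerBrDr addrC natr1 ler_nat.
Qed.

Section Repetitive.
Context {R : realType} {d : nat} {I : Type}.
Local Notation rV := 'rV[R]_d.
Local Notation mset := (multiset R d I).
Variables (Lam : mset) (Lc : R).
Hypothesis rep_Lam : linearly_repetitive_with Lc Lam.
Hypothesis aper : aperiodic Lam.
Implicit Types (L : mset) (x y p t : rV) (r e T c : R).

(** The extra 1 in the radius makes the inequality with the infimum that defines [repetitivity]
    strict, so that an actual radius is obtained. *)
Lemma repetitive_copy r (c : rV) p : 1 <= r -> supp Lam p ->
  exists q, [/\ supp Lam q, cball c (Lc * r + 1) q &
    centered_cluster Lam r q = centered_cluster Lam r p].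
Proof.
move=> r1 Lp; have [_ /(_ r r1) H] := rep_Lam.
have {}H : (repetitivity Lam r < (Lc * r + 1)%:E)%E.
  by apply: le_lt_trans H _; rewrite lte_fin ltrDl.
have [_ [T [_ /(_ c p Lp) [q [Lq cq E]]] <-]] := ereal_inf_lt H.
rewrite lte_fin => /ltW Tr; exists q; split=> //.
exact: le_trans Tr.
Qed.

Lemma cluster_point r p q w (i : I) :
  centered_cluster Lam r p = centered_cluster Lam r q -> enorm w <= r ->
  Lam (p + w, i) -> Lam (q + w, i).
Proof.
move=> E wr; have := @bstar_supp _ _ _ _ _ _ w i E wr.
by rewrite /phi /= ![w + _]addrC.
Qed.

(** With [r' = kap * r >= 1], copies of [r']-clusters occur within
    [Lc * r' + 1 <= (Lc + 1) * r' = r / 2], well inside an [r]-cluster. *)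
Let kap : R := (2 * (Lc + 1))^-1.

(* A translation between two occurrences of a large cluster that is short
   compared to its radius is a period: by repetitivity all the clusters of a
   proportional radius occur inside it. *)
Lemma repulsion r p q : 2 * (Lc + 1) <= r -> supp Lam p -> supp Lam q ->
  centered_cluster Lam r p = centered_cluster Lam r q ->
  enorm (p - q) < kap * r -> p = q.
Proof.
have [Lc1 _] := rep_Lam.
move=> rL Lp Lq E pq; have Lk : kap * (2 * (Lc + 1)) = 1.
  by rewrite mulVf // gt_eqF //; lra.
have k0 : 0 < kap by rewrite invr_gt0; lra.
pose r' := kap * r.
have r'1 : 1 <= r' by rewrite -Lk /r' ler_pM2l.
have Lr' : Lc * r' + 1 <= r.
  have : r' * (2 * (Lc + 1)) = r by rewrite /r' mulrAC Lk mul1r.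
  nra.
(* A point [y] has a copy [y'] of its [r']-cluster near [p']. Moving [y'] by [q' - p'] stays in
   [Lam] because the clusters at [p'] and [q'] agree; as this step is shorter than [r'], it is
   visible in the cluster of [y'], hence also at [y]. *)
have shift_in p' q' : supp Lam p' -> enorm (p' - q') < r' ->
    centered_cluster Lam r p' = centered_cluster Lam r q' ->
    forall y i, Lam (y, i) -> Lam (y + (q' - p'), i).
  move=> Lp' pq' E' y i Ly.
  have [y' [Ly' y'p Ey]] := repetitive_copy p' r'1 (ex_intro _ i Ly).
  have Ly'i : Lam (y', i).
    rewrite -[y']addr0; apply: cluster_point (esym Ey) _ _.
      by rewrite enorm0; lra.
    by rewrite addr0.
  apply: (cluster_point Ey); first by rewrite enormB ltW.
  rewrite (_ : y' + (q' - p') = q' + (y' - p')); last by rewrite addrCA.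
  apply: (cluster_point E'); first by apply: le_trans y'p _.
  by rewrite subrKC.
have H1 := shift_in _ _ Lp pq E.
have H2 := shift_in q p Lq ltac:(by rewrite enormB) (esym E).
apply/eqP; rewrite eq_sym -subr_eq0; apply/eqP/aper/seteqP.
split=> -[y i]; rewrite /phi /= => Ly; last exact: H1.
by have := H2 _ _ Ly; rewrite -addrA subrKA subrr addr0.
Qed.

Lemma kap_gt0 : 0 < kap.
Proof. by have [Lc1 _] := rep_Lam; rewrite invr_gt0; lra. Qed.

Definition near_occurrence s r (p0 : rV) : set rV := [set q | exists p,
  [/\ supp Lam p, enorm (p - q) <= s &
      centered_cluster Lam r p = centered_cluster Lam r p0]].

(* The points within [c r] of an occurrence of a given [r]-cluster are sparse:
   around each occurrence the configuration near its center is repeated [m]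
   times along a segment, within the zone free of other occurrences. *)
Lemma near_occurrence_sparse (k0 : 'I_d) r0 m : 0 < r0 -> separated Lam r0 ->
  (0 < m)%N ->
  exists (c R1 : R), [/\ 0 < c, 0 < R1 & forall r, R1 <= r -> forall p0 T, 0 <=
    T ->
    (count_set (points Lam 0 T `&` near_occurrence (c * r)%R r p0) * m
     <= count_set (points Lam 0 (T + r)%R))%N].
Proof.
move=> r00 sep m0; have [Lc1 _] := rep_Lam; have kap0 := kap_gt0.
have m0' : 0 < m%:R :> R by rewrite ltr0n.
have km0 : 0 < 4 * m%:R * (2 * Lc + 5) by rewrite !mulr_gt0 //; lra.
pose c := kap / (4 * m%:R * (2 * Lc + 5)).
have c0 : 0 < c by rewrite divr_gt0.
(* The bound on [r] ensures both [2 * (Lc + 1) <= r], for [repulsion], and [1 <= c * r], for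
   [repetitive_copy]. *)
exists c, (2 * (Lc + 1) + c^-1); split=> //.
  by have : 0 < c^-1 by [rewrite invr_gt0]; lra.
move=> r Rr p0 T T0; have ci0 : 0 < c^-1 by rewrite invr_gt0.
pose rho := c * r.
have rho1 : 1 <= rho by rewrite /rho -[leLHS](mulfV (lt0r_neq0 c0)) ler_pM2l
  //; lra.
have r0' : 0 < r by lra.
have rL : 2 * (Lc + 1) <= r by lra.
(* The spacing of the copies along the segment: one more than twice the error [Lc * rho + 1 + rho]
   of the position of a copied point. The constant [c] is such that [m] spacings take less than half
   of the repulsion distance [kap * r]. *)
pose D := 2 * (Lc * rho + 1 + rho) + 1.
have Lrho : 0 < Lc * rho by rewrite mulr_gt0 //; lra.
have DE : D = 2 * (Lc * rho + 1 + rho) + 1 by [].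
have D0 : 0 < D by lra.
have LD : Lc * rho + 1 + rho <= D by lra.
have mD : m%:R * D < kap * r / 2.
  have : D <= (2 * Lc + 5) * rho by rewrite /D; lra.
  have : m%:R * ((2 * Lc + 5) * rho) = kap * r / 4.
    by rewrite /rho /c; field; rewrite !gt_eqF //; lra.
  have : 0 < kap * r by rewrite mulr_gt0.
  by move=> ? ? ?; have : m%:R * D <= m%:R * ((2 * Lc + 5) * rho);
    [rewrite ler_pM2l|lra].
pose e1 : rV := delta_mx 0 k0.
have e1n : enorm e1 = 1.
  rewrite /enorm /dotp (bigD1 k0) //= big1 ?addr0 ?mxE ?eqxx ?mul1r ?sqrtr1 //.
  by move=> i ik; rewrite !mxE eqxx /= (negbTE ik) mul0r.
have copy p j : exists y, supp Lam p -> [/\ supp Lam y,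
    enorm (y - (p + (j%:R * D) *: e1)) <= Lc * rho + 1 &
    centered_cluster Lam rho y = centered_cluster Lam rho p].
  have [Lp|nLp] := pselect (supp Lam p); last by exists 0.
  by have [y [? ? ?]] := repetitive_copy (p + (j%:R * D) *: e1) rho1 Lp;
    exists y.
have [Y0 hY0] := choice (fun z : rV * nat => copy z.1 z.2).
pose Y p j := Y0 (p, j).
have hY p j := hY0 (p, j).
pose near_p q p := [/\ supp Lam p, enorm (p - q) <= c * r &
  centered_cluster Lam r p = centered_cluster Lam r p0].
pose P q := xget 0 (near_p q).
have PP q : (exists p, near_p q p) -> near_p q (P q).
  by move=> [p pq]; rewrite /P; case: xgetP => // /(_ p).
have fB : finite_set (points Lam 0 (T + r)).
  have [C _ H] := separated_count r00 sep.
  by have [] := H 0 (T + r) ltac:(lra).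
have dist q j : points Lam 0 T q -> near_p q (P q) -> (j < m)%N ->
    [/\ supp Lam (Y (P q) j + (q - P q)),
     enorm (Y (P q) j + (q - P q) - (P q + (j%:R * D) *: e1)) <= Lc * rho + 1 +
       rho &
     enorm (Y (P q) j + (q - P q) - P q) <= m%:R * D].
  move=> [[i Lq] _] [Lp pq _] jm; have [/= LY Yd YE] := hY _ j Lp.
  have H : enorm (Y (P q) j + (q - P q) - (P q + (j%:R * D) *: e1)) <=
      Lc * rho + 1 + rho.
    rewrite addrAC; apply: le_trans (enormD _ _) _; apply: lerD => //.
    by rewrite enormB.
  split=> //.
    exists i; apply: cluster_point (esym YE) _ _; first by rewrite enormB.
    by rewrite subrKC.
  rewrite -(subrKA (P q + (j%:R * D) *: e1)); apply: le_trans (enormD _ _) _.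
  rewrite [P q + _ - P q]addrAC subrr add0r enormZ e1n mulr1.
  rewrite ger0_norm; last by rewrite mulr_ge0 // ltW.
  have : (j.+1)%:R * D <= m%:R * D by rewrite ler_pM2r // ler_nat.
  rewrite -natr1 mulrDl mul1r; move: H LD; lra.
(* The [j]-th image of [q] is its counterpart in the [j]-th copy of the small cluster around the
   occurrence [P q]. *)
apply: (count_mul_le (f := fun q j => Y (P q) j + (q - P q)) m0 fB _ _).2.
- move=> q j [Tq /PP pq] jm; have [? _ H] := dist q j Tq pq jm; split=> //.
  have [_ qT] := Tq; have [_ pqr _] := pq; move: qT;
    rewrite /cball /= !subr0 => qT.
  set z := Y (P q) j + (q - P q) in H *;
    have -> : z = (z - P q) + (P q - q) + q.
    by apply/rowP => k; rewrite !mxE; ring.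
  have := enormD (z - P q + (P q - q)) q; have := enormD (z - P q) (P q - q).
  have : kap * r <= 4^-1 * r.
    by rewrite ler_pM2r // lef_pV2 ?posrE //; lra.
  have : c * r <= kap * r.
    rewrite ler_pM2r // /c ler_pdivrMr // ler_peMr // ?(ltW kap0) //.
    have m1 : 1 <= m%:R :> R by rewrite ler1n.
    have : 1 * 1 <= m%:R * (2 * Lc + 5) by apply: ler_pM => //; lra.
    lra.
  lra.
move=> q q' j j' [Tq /PP pq] [Tq' /PP pq'] jm jm' E.
have [_ d1 H] := dist q j Tq pq jm; have [_ d1' H'] := dist q' j' Tq' pq' jm'.
have [Lp pqr pE] := pq; have [Lp' pqr' pE'] := pq'.
(* A common image is within [m%:R * D] of both occurrences, which forces them to coincide by
   [repulsion]. *)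
have PE : P q = P q'.
  apply: (repulsion rL Lp Lp' (etrans pE (esym pE'))).
  rewrite -E in H'; rewrite enormB in H; rewrite enormB in H'.
  by apply: le_lt_trans (enorm_triD H H') _; rewrite [ltRHS]splitr ltrD.
move: E d1 d1'; rewrite -PE => E d1 d1'.
(* Different labels are aimed at points at least [D] apart, whereas the two errors add up to at most
   [D - 1]. *)
have jE : j = j'.
  apply/eqP; apply: contraT => jj'.
  have : enorm ((j%:R * D) *: e1 - (j'%:R * D) *: e1) <= D - 1.
    set z := Y (P q) j + _ in E d1; rewrite -E in d1'.
    have -> : (j%:R * D) *: e1 - (j'%:R * D) *: e1 =
       (z - (P q + (j'%:R * D) *: e1)) - (z - (P q + (j%:R * D) *: e1)).
      by apply/rowP => k; rewrite !mxE; ring.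
    by apply: le_trans (enormD _ _) _; rewrite enormN; move: d1 d1' DE;
      clear; lra.
  rewrite -scalerBl enormZ e1n mulr1 -mulrBl normrM (gtr0_norm D0).
  have : 1 <= `|j%:R - j'%:R| :> R.
    exact: natr_dist_ge1.
  by move=> /(ler_wpM2r (ltW D0)); rewrite mul1r; clear; lra.
by subst j'; move: E => /addrI; rewrite PE => /addIr.
Qed.

End Repetitive.

(** * Frequencies of local events *)

(** For [k = d.+1 * j] the right side is the power [d.+1] of [2 ^ j >= j.+1], one factor more than
    the left side has; [j] is chosen to let this factor beat the constant. *)
Lemma expn2_beats_power (R : realType) (C : R) d :
  exists k : nat, C * k.+1%:R ^+ d < 2 ^+ k.
Proof.
pose K := C * d.+1%:R ^+ d.
pose j := (Num.truncn `|K|).+1.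
exists (d.+1 * j)%N.
have Kj : K < j.+1%:R.
  have := truncnS_gt `|K|; rewrite -/j => Kj.
  by apply: le_lt_trans (ler_norm _) _; apply: lt_trans Kj _; rewrite ltr_nat.
have -> : (2 : R) ^+ (d.+1 * j) = (2 ^+ j) ^+ d.+1 by rewrite -exprM mulnC.
apply: (@lt_le_trans _ _ (j.+1%:R ^+ d.+1)); last first.
  by rewrite lerXn2r ?nnegrE // -natrX ler_nat ltn_expl.
apply: (@le_lt_trans _ _ (`|C| * (d.+1%:R * j.+1%:R) ^+ d)).
  apply: (@le_trans _ _ (`|C| * (d.+1 * j).+1%:R ^+ d)).
    by rewrite ler_wpM2r // ler_norm.
  rewrite ler_wpM2l // lerXn2r ?nnegrE // -natrM ler_nat mulnS.
  by rewrite addSn ltnS leq_addl.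
have Kn : `|K| < j.+1%:R.
  by apply: lt_trans (truncnS_gt `|K|) _; rewrite ltr_nat.
rewrite exprMn mulrA exprS ltr_pM2r ?exprn_gt0 //.
by move: Kn; rewrite /K normrM (ger0_norm (exprn_ge0 _ _)).
Qed.

Section SlowGrowth.
Context {R : realType} {d : nat} {I : Type}.
Local Notation rV := 'rV[R]_d.
Local Notation mset := (multiset R d I).
Implicit Types (L : mset) (r e T s : R).

Lemma points_monotone L T T' : T <= T' -> points L 0 T `<=` points L 0 T'.
Proof. by move=> TT' q [Lq qT]; split=> //; exact: le_trans TT'. Qed.

(** Otherwise the count would more than double at each step of length [s], against its polynomial
    growth. *)
Lemma slow_growth L r0 s T0 : 0 < r0 -> separated L r0 -> supp L !=set0 ->
  0 < s -> exists T, [/\ T0 <= T, 0 <= T &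
    (count_set (points L 0 (T + s)%R) <= 2 * count_set (points L 0 T))%N].
Proof.
move=> r00 sep [p Lp] s0; apply: contrapT => H.
have [C C0 hC] := separated_count r00 sep.
pose T1 := Num.max T0 (enorm p).
have T10 : T0 <= T1 by rewrite le_max lexx.
have pT1 : enorm p <= T1 by rewrite le_max lexx orbT.
have T1p : 0 <= T1 := le_trans (enorm_ge0 p) pT1.
pose a T := count_set (points L 0 T).
have grow k : (2 ^ k <= a (T1 + k%:R * s)%R)%N.
  elim: k => [|k IH].
    rewrite mul0r addr0 expn0 /a /count_set cardfs_gt0.
    apply/fset0Pn; exists p; apply/mem_fset_set_iff.
      by have [] := hC 0 T1 T1p.
    by split=> //; rewrite /cball /= subr0.
  rewrite expnS; apply: (@leq_trans (2 * a (T1 + k%:R * s)%R)).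
    by rewrite leq_mul2l.
  rewrite leqNgt; apply/negP => lt; apply: H; exists (T1 + k%:R * s).
  have ks : 0 <= k%:R * s by rewrite mulr_ge0 // ltW.
  split; [lra|lra|].
  by apply/ltnW; move: lt; rewrite -natr1 mulrDl mul1r addrA.
have [k] := expn2_beats_power (C * (T1 + s + 1) ^+ d) d.
have kT : 0 <= T1 + k%:R * s by rewrite addr_ge0 // mulr_ge0 // ltW.
have [_] := hC 0 _ kT.
have : (2 ^+ k : R) <= (a (T1 + k%:R * s))%:R by rewrite -natrX ler_nat.
rewrite /a => ? ? E.
have : C * (T1 + k%:R * s + 1) ^+ d <= C * (T1 + s + 1) ^+ d * k.+1%:R ^+ d.
  rewrite -mulrA ler_pM2l // -exprMn lerXn2r ?nnegrE //.
  - by lra.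
  - by rewrite mulr_ge0 //; lra.
  - have : 0 <= k%:R * T1 by rewrite mulr_ge0.
    by have : 0 <= k%:R :> R; rewrite // -natr1; lra.
lra.
Qed.

End SlowGrowth.

Section LocalSets.
Context {R : realType} {d : nat} {I : Type}.
Local Notation rV := 'rV[R]_d.
Local Notation mset := (multiset R d I).
Variables (Lam : mset) (r0 : R).
Hypothesis r00 : 0 < r0.
Hypothesis sep : separated Lam r0.
Implicit Types (L : mset) (r e : R) (Q : set mset).

Definition local_set r Q : set mset :=
  [set L | canonical_transversal Lam L /\ Q (bstar r 0 `&` L)].

Lemma good_scale r : exists e, [/\ 0 < e, e <= (Num.sqrt 2)^-1,
  e + e <= r0 & r + e <= e^-1].
Proof.
pose e : R := Num.min (Num.sqrt 2)^-1 (Num.min (r0 / 2) (`|r| + 1)^-1).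
have r1 : 0 < `|r| + 1 by have := normr_ge0 r; lra.
have e0 : 0 < e.
  by rewrite !lt_min !invr_gt0 sqrtr_gt0 ltr0n /= divr_gt0 //= r1.
exists e; split=> //; first by rewrite ge_min lexx.
  have : e <= r0 / 2 by rewrite !ge_min lexx orbT.
  lra.
have er : e <= (`|r| + 1)^-1 by rewrite !ge_min lexx !orbT.
have er' : `|r| + 1 <= e^-1 by rewrite -[leLHS]invrK lef_pV2 ?posrE ?invr_gt0.
have : (`|r| + 1)^-1 <= 1 by rewrite invf_le1 //; have := normr_ge0 r; lra.
have := ler_norm r; lra.
Qed.

Lemma near_transversal_point e L L' : hull Lam L -> supp L' 0 ->
  0 < e -> e <= (Num.sqrt 2)^-1 ->
  mset_dist L L' < e -> exists2 w, supp L w & enorm w < e + e.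
Proof.
move=> hL [j L'0] e0 es /mset_dist_lt [|[a ae [a0 [x [y [xa ya E]]]]]].
  by rewrite ltNge es.
move: xa ya; rewrite /cball /= !subr0 => xa ya.
have s1 : (Num.sqrt 2)^-1 <= 1 :> R.
  by rewrite invf_le1 ?sqrtr_gt0 // -[leLHS]sqrtr1 ler_sqrt //; lra.
have a1 : 1 <= a^-1 by rewrite -invr1 lef_pV2 ?posrE; lra.
exists (- y + x).
  exists j; apply: (bstar_supp (esym E)); first by rewrite enormN; lra.
  by rewrite /phi /= addNr.
by apply: le_lt_trans (enormD _ _) _; rewrite enormN; lra.
Qed.

(** Sufficiently near elements of the transversal have the same pattern of radius [r], so [Q] may be
    arbitrary. What has to be shown is that limits in the space of all multisets still have a point
    at the origin. *)
Lemma closed_local_set r Q : closed (local_set r Q).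
Proof.
move=> L cL.
have near e : 0 < e -> exists2 L', local_set r Q L' & mset_dist L L' < e.
  by move=> e0; have [L' [? ?]] := cL _ (nbhsx_ballx L e e0); exists L'.
have hL : hull Lam L.
  apply: (@closed_closure _ (range (phi^~ Lam))).
  by apply: closure_subset cL => L' [[]].
have s0 : 0 < (Num.sqrt 2)^-1 :> R by rewrite invr_gt0 sqrtr_gt0.
have pt e : 0 < e -> exists2 w, supp L w & enorm w < e.
  move=> e0; pose e' := Num.min (Num.sqrt 2)^-1 (e / 2).
  have e'0 : 0 < e' by rewrite lt_min s0 divr_gt0.
  have [L' [[hL' L'0] _] LL'] := near e' e'0.
  have [|w Lw wl] := near_transversal_point hL L'0 e'0 _ LL'.
    by rewrite ge_min lexx.
  exists w => //; apply: lt_le_trans wl _.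
  have : e' <= e / 2 by rewrite ge_min lexx orbT.
  lra.
have sL := separated_hull sep hL.
(* [L] has points arbitrarily close to 0; if a first one [w1] were nonzero, one closer than [w1]
   would coincide with it by separation. *)
have L0 : supp L 0.
  have r02 : 0 < r0 / 2 by rewrite divr_gt0.
  have [w1 Lw1 w1l] := pt (r0 / 2) r02.
  have [w10|w1n] := eqVneq w1 0; first by rewrite -w10.
  have w1p : 0 < enorm w1.
    rewrite lt_neqAle enorm_ge0 andbT eq_sym; apply: contra_neq w1n.
    exact: enorm_eq0.
  have [w2 Lw2 w2l] := pt (enorm w1) w1p.
  have w12 : w1 = w2.
    apply: sL => //; apply: le_trans (enormD _ _) _; rewrite enormN; lra.
  by move: w2l; rewrite -w12 ltxx.
split; first by split.
have [e [e0 es er re]] := good_scale r.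
have [L' [tL' QL'] LL'] := near e e0.
by rewrite (transversal_near sep e0 es er re hL tL' L0 LL').
Qed.

Lemma measurable_local_set r Q : measurable (local_set r Q : set (borel mset)).
Proof.
rewrite -[X in measurable X]setCK; apply: measurableC.
by apply: sub_sigma_algebra; rewrite /= openC; exact: closed_local_set.
Qed.

Lemma local_setT r : local_set r setT = canonical_transversal Lam.
Proof. by apply/seteqP; split=> L [] //. Qed.

End LocalSets.

Lemma count_disjointU (T : choiceType) (A B : set T) : finite_set A ->
  finite_set B -> A `&` B = set0 ->
  count_set (A `|` B) = (count_set A + count_set B)%N.
Proof.
move=> fA fB AB; rewrite /count_set fset_setU // cardfsU.
by rewrite -fset_setI // AB fset_set0 cardfs0 subn0.
Qed.

Section Frequency.
Context {R : realType} {d : nat}.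
Local Notation rV := 'rV[R]_d.
Local Notation mset := (multiset R d (color R d)).
Variables (Lam : mset) (r0 : R).
Hypothesis r00 : 0 < r0.
Hypothesis sep : separated Lam r0.
Hypothesis flc : finite_local_complexity Lam.
Variable nu : {finite_measure set (borel mset) -> \bar R}.
Hypothesis hnu : frequency_measure Lam nu.
Implicit Types (L : mset) (r e T : R) (Q : set mset).

Definition count_local r Q T : nat :=
  count_set (points Lam 0 T `&` [set q | Q (centered_cluster Lam r q)]).

Let g T : R := fine (vol (cball (0 : rV) T)).

Lemma finite_points T : finite_set (points Lam 0 T).
Proof.
have [C _ H] := separated_count r00 sep.
have [|fT _] := H 0 (Num.max T 0); first by rewrite le_max lexx orbT.
by apply: sub_finite_set fT; apply: points_monotone; rewrite le_max lexx.
Qed.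

Lemma finite_points_sub T (A : set rV) : finite_set (points Lam 0 T `&` A).
Proof. by apply: sub_finite_set (finite_points T); exact: subIsetl. Qed.

Lemma frequency_seq r (s : seq mset) : 0 < r -> uniq s ->
  (forall P, P \in s -> [set centered_cluster Lam r p | p in supp Lam] P) ->
  (count_local r [set` s] T)%:R / g T @[T --> +oo] -->
    fine (nu (local_set Lam r [set` s])).
Proof.
move=> r_gt0; elim: s => [_ _|P s IH /= /andP[Ps us] sK].
  rewrite (_ : local_set _ _ _ = set0); last first.
    by apply/seteqP; split=> L // [].
  rewrite measure0 /= (_ : (fun T => _) = fun=> 0); first exact: cvg_cst.
  apply/funext => T; rewrite /count_local (_ : _ `&` _ = set0).
    by rewrite /count_set fset_set0 cardfs0 mul0r.
  by apply/seteqP; split=> q // [].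
have [p Lp pP] := sK P (mem_head _ _).
have disj : [set P] `&` [set` s] = set0.
  by apply/seteqP; split=> X // [/= -> ]; rewrite (negbTE Ps).
have sU : [set` P :: s] = [set P] `|` [set` s].
  apply/seteqP; split=> X /=; rewrite inE.
    by move=> /orP[/eqP ->|]; [left|right].
  by move=> [->|->]; rewrite ?eqxx ?orbT.
have {}IH : (count_local r [set` s] T)%:R / g T @[T --> +oo] -->
    fine (nu (local_set Lam r [set` s])).
  by apply: IH => // P' P's; apply: sK; rewrite inE P's orbT.
have -> : local_set Lam r [set` P :: s] =
    local_set Lam r [set P] `|` local_set Lam r [set` s].
  rewrite sU; apply/seteqP; split=> L /=.
    by move=> [tL [|]]; [left|right].
  by move=> [[tL ?]|[tL ?]]; split=> //; [left|right].
have mE Q := measurable_local_set r00 sep r Q.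
rewrite measureU //; last first.
  apply/seteqP; split=> L // [[_ LP] [_ Ls]].
  by have : ([set P] `&` [set` s]) (bstar r 0 `&` L) by []; rewrite disj.
rewrite fineD ?fin_num_measure //.
have -> : (fun T => (count_local r [set` P :: s] T)%:R / g T) =
  (fun T => (count_local r [set P] T)%:R / g T +
            (count_local r [set` s] T)%:R / g T).
  apply/funext => T; rewrite -mulrDl -natrD; congr (_%:R / _).
  rewrite /count_local -count_disjointU; [|exact: finite_points_sub..|].
    by rewrite -setIUr sU.
  rewrite -setIIr; apply/seteqP; split=> q // [_ H].
  by have : ([set P] `&` [set` s]) (centered_cluster Lam r q) by [];
    rewrite disj.
apply: cvgD => //.
have := hnu.2 r p r_gt0 Lp; rewrite pP.
suff -> : (fun T => (count_local r [set P] T)%:R / g T) = (fun T =>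
   (count_set [set q | [/\ supp Lam q, cball 0 T q &
      centered_cluster Lam r q = P]])%:R / g T) by [].
apply/funext => T; congr (_%:R / _); congr count_set.
by apply/seteqP; split=> q; [move=> [[]]|move=> []].
Qed.

(** By finite local complexity only finitely many patterns of radius [r] occur, so the frequencies
    of single clusters add up for arbitrary [Q]. *)
Lemma frequency_local r Q : 0 < r ->
  (count_local r Q T)%:R / g T @[T --> +oo] --> fine (nu (local_set Lam r Q)).
Proof.
move=> r_gt0; have /finite_seqP [s sE] := flc r_gt0.
pose s' := [seq P <- undup s | `[< Q P >]].
have s'E P : P \in s' <-> Q P /\ exists2 p, supp Lam p & centered_cluster Lam r
  p = P.
  rewrite mem_filter mem_undup; split.
    move=> /andP[/asboolP QP sP]; split=> //.
    by have : [set` s] P by []; rewrite -sE.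
  move=> [QP Kp]; apply/andP; split; first exact/asboolP.
  by have : [set centered_cluster Lam r p | p in supp Lam] P by []; rewrite sE.
have -> : local_set Lam r Q = local_set Lam r [set` s'].
  apply/seteqP; split=> L [tL QL]; split=> //=; last by case/s'E: QL.
  apply/s'E; split=> //; have [p Lp ->] := transversal_local r tL; by exists p.
have -> : (fun T => (count_local r Q T)%:R / g T) =
    (fun T => (count_local r [set` s'] T)%:R / g T).
  apply/funext => T; congr (_%:R / _); congr count_set.
  apply/seteqP; split=> q [Tq Qq]; split=> //=; last by case/s'E: Qq.
  by apply/s'E; split=> //; exists q => //; case: Tq.
apply: frequency_seq => //; first by rewrite filter_uniq // undup_uniq.
by move=> P /s'E [].
Qed.

Variable Lc : R.
Hypothesis rep_Lam : linearly_repetitive_with Lc Lam.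
Hypothesis aper : aperiodic Lam.

Definition near_cluster s r (p0 : rV) : set mset :=
  [set X | exists2 p, enorm p <= s &
     bstar r 0 `&` phi p X = centered_cluster Lam r p0].

Lemma near_cluster_local s r p0 L :
  near_cluster s r p0 (bstar (r + s) 0 `&` L) <-> near_cluster s r p0 L.
Proof.
have E p : enorm p <= s ->
    bstar r 0 `&` phi p (bstar (r + s) 0 `&` L) = bstar r 0 `&` phi p L.
  move=> ps; apply: (@mset_dist_shrink _ _ _ _ _ (r + s)).
    by rewrite addrC lerD2l.
  by rewrite setIA setIid.
by split=> -[p ps H]; exists p => //; rewrite -H E.
Qed.

(* Compares the two counting functions at radii where the points of [Lam] grow
   slowly, so that the normalization by volumes cancels out. *)
Lemma near_cluster_frequency (k0 : 'I_d) m : (0 < m)%N ->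
  exists (c R1 : R), [/\ 0 < c, 0 < R1 & forall r, R1 <= r ->
    forall p0, supp Lam p0 ->
    fine (nu (local_set Lam (r + c * r) (near_cluster (c * r) r p0))) * m%:R <=
    2 * fine (nu (canonical_transversal Lam))].
Proof.
move=> m0; have [c [R1 [c0 R10 H]]] := near_occurrence_sparse rep_Lam aper k0
  r00 sep m0.
exists c, R1; split=> // r Rr p0 Lp0.
have r_gt0 : 0 < r by apply: lt_le_trans Rr.
have cr : 0 < c * r by rewrite mulr_gt0.
set N := near_cluster _ _ _.
have cN := @frequency_local (r + c * r) N (addr_gt0 r_gt0 cr).
have cA := @frequency_local 1 setT ltr01.
rewrite local_setT in cA.
(* If the inequality failed, the difference of the normalized counts would be eventually positive;
   at a radius given by [slow_growth], sparseness makes it nonpositive. *)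
rewrite leNgt; apply/negP => lt.
have : (count_local (r + c * r) N T)%:R / g T * m%:R
   - 2 * ((count_local 1 setT T)%:R / g T) @[T --> +oo] -->
   fine (nu (local_set Lam (r + c * r) N)) * m%:R
   - 2 * fine (nu (canonical_transversal Lam)).
  by apply: cvgB; [apply: cvgMl|apply: cvgMr].
move=> /cvgr_gt /(_ 0); rewrite subr_gt0 => /(_ lt) [T1 [_ hT1]].
have [T [T1T T0 growT]] := slow_growth (T1 + 1) r00 sep (ex_intro _ p0 Lp0)
  r_gt0.
have T1T' : T1 < T by lra.
have := hT1 T T1T'; apply/negP; rewrite -leNgt /=.
have g0 : 0 <= (g T)^-1.
  rewrite invr_ge0 /g fine_ge0 //; apply: leb_integral_ge0 => y.
  by rewrite lee_fin indicE.
have -> (x y : R) : x / g T * m%:R - 2 * (y / g T) =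
    (x * m%:R - 2 * y) * (g T)^-1 by ring.
apply: mulr_le0_ge0 => //; rewrite subr_le0 -!natrM ler_nat.
apply: (@leq_trans (count_set (points Lam 0 (T + r)%R))); last first.
  apply: leq_trans growT _; rewrite leq_mul2l /count_local.
  by apply: count_sub; [exact: finite_points_sub|move=> q].
apply: leq_trans (H r Rr p0 T T0); rewrite leq_mul2r; apply/orP; right.
apply: count_sub; first exact: finite_points_sub.
move=> q [Tq /near_cluster_local [p pc pE]]; split=> //.
rewrite phi_phi in pE; exists (p + q); split=> //; last by rewrite addrK.
have [i Lp0i] := Lp0; exists i.
suff : phi (p + q) Lam (0, i) by rewrite /phi /= add0r.
apply: (bstar_supp (esym pE)); first by rewrite enorm0 ltW.
by rewrite /phi /= add0r.
Qed.

End Frequency.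

(** * Absolute continuity *)

Lemma countable_bigcup_null d (T : measurableType d) (R : realType)
    (mu : {measure set T -> \bar R}) (I : Type) (A : set I) (F : I -> set T) :
  countable A -> (forall a, A a -> mu.-negligible (F a)) ->
  mu.-negligible (\bigcup_(a in A) F a).
Proof.
move=> /pcard_leP [f] F0.
have finj : {in A &, injective f} by move=> x y xA yA; exact: inj.
have sub : \bigcup_(a in A) F a `<=`
    \bigcup_n (\bigcup_(a in [set a | A a /\ f a = n]) F a).
  by move=> t [a Aa Fa]; exists (f a) => //; exists a.
apply: negligibleS sub _; apply: negligible_bigcup => n.
have [[a [Aa fan]]|nA] := pselect (exists a, A a /\ f a = n).
  apply: negligibleS (F0 a Aa) => t [b [Ab fbn] Fb].
  by rewrite (finj a b) ?inE // fan fbn.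
apply: negligibleS (negligible_set0 _) => t [b [Ab fbn] _].
by apply: nA; exists b.
Qed.

Section IntegralOffNull.
Import HBNNSimple.

(** [f] is arbitrary: the integral is a supremum over simple functions below [f], all of which
    vanish off [N]. This matters since a Borel set of the phase space may fail to be measurable for
    the product of the Borel sigma-algebras. *)
Lemma integral_off_null d (T : measurableType d) (R : realType)
    (m : {measure set T -> \bar R}) (N : set T) (f : T -> \bar R) :
  measurable N -> m N = 0%E -> (forall x, (0 <= f x)%E) ->
  (forall x, ~ N x -> f x = 0%E) -> (\int[m]_x f x = 0)%E.
Proof.
move=> mN N0 f0 fN; apply/eqP; rewrite eq_le integral_ge0 ?andbT //.
rewrite ge0_integralTE //; apply: ge_ereal_sup => _ [h hf <-].
rewrite -integralT_nnsfun.
have -> : (fun x => (h x)%:E) = (EFin \o h) \_ N.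
  apply/funext => x; rewrite patchE; case: ifPn => // /negP Nx.
  have fx0 : f x = 0%E by apply: fN => ?; apply: Nx; rewrite inE.
  apply/eqP; rewrite eq_le; apply/andP; split; first by have := hf x;
    rewrite fx0.
  by rewrite lee_fin.
rewrite -integral_mkcond null_set_integral //.
exact/measurable_EFinP/measurable_funTS.
Qed.

End IntegralOffNull.

Lemma product_measure_null d1 d2 d3 (T1 : measurableType d1)
    (T2 : measurableType d2) (T3 : measurableType d3) (R : realType)
    (m1 : {measure set T1 -> \bar R})
    (m2 : {sigma_finite_measure set T2 -> \bar R})
    (m3 : {measure set T3 -> \bar R}) (E : set T2)
    (A : set (T1 * T2 * T3)) : measurable E -> m2 E = 0%E ->
  (forall w, A w -> E w.1.2) -> (m1 \x m2 \x m3)%E A = 0%E.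
Proof.
move=> mE E0 AE; rewrite /product_measure1.
apply: (@integral_off_null _ _ _ (m1 \x m2)%E (setT `*` E)) => //.
- exact: measurableX.
- by have := product_measure1E m1 m2 measurableT mE; rewrite E0 mule0.
- move=> w nE /=; rewrite (_ : xsection A w = set0) ?measure0 //.
  by apply/seteqP; split=> // t; rewrite /xsection /= inE => /AE wE; apply: nE.
Qed.

Lemma closed_measurable (T : ptopologicalType) (A : set T) :
  closed A -> measurable (A : set (borel T)).
Proof.
move=> cA; rewrite -[X in measurable X]setCK; apply: measurableC.
by apply: sub_sigma_algebra; rewrite /= openC.
Qed.

Lemma open_measurable_borel (T : ptopologicalType) (A : set T) :
  open A -> measurable (A : set (borel T)).
Proof. exact: sub_sigma_algebra. Qed.

Lemma continuous_measurable (T U : ptopologicalType) (f : T -> U)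
    (A : set (borel U)) : continuous f -> measurable A ->
  measurable (f @^-1` A : set (borel T)).
Proof.
move=> cf mA; rewrite -[X in measurable X]setTI.
suff mf : measurable_fun (T := borel T) (U := borel U) setT f by exact: mf.
apply: (@measurability _ _ (borel T) (borel U) setT f (@open U)) => //.
move=> _ [B oB <-]; rewrite setTI; apply: open_measurable_borel.
by apply: open_comp => // x _; exact: cf.
Qed.

(** * Measurability of the collision space *)

Section CollisionSpace.
Context {R : realType} {d : nat}.
Local Notation rV := 'rV[R]_d.
Local Notation mset := (multiset R d (color R d)).
Local Notation Z := (phase_space R d).
Variable S : set (set rV).
Hypothesis hS : scatterer_configuration S.
Hypothesis hdelone : delone_multiset (colors S) (Lambda S).
Local Notation Lam := (Lambda S).

Definition zcolor (z : Z) : discrete_topology (color R d) := z.1.1.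
Definition zpos (z : Z) : rV := z.1.2.1.
Definition zvel (z : Z) : rV := z.1.2.2.
Definition zconf (z : Z) : mset := z.2.

Lemma continuous_zcolor : continuous zcolor.
Proof. exact: continuous_compT (@continuous_fst _ _) (@continuous_fst _ _). Qed.

Lemma continuous_zpos : continuous zpos.
Proof.
apply: continuous_compT (@continuous_fst _ _).
exact: continuous_compT (@continuous_fst _ _) (@continuous_snd _ _).
Qed.

Lemma continuous_zvel : continuous zvel.
Proof.
apply: continuous_compT (@continuous_snd _ _).
exact: continuous_compT (@continuous_fst _ _) (@continuous_snd _ _).
Qed.

Lemma continuous_zconf : continuous zconf.
Proof. exact: continuous_snd. Qed.

Lemma closed_preim (T U : topologicalType) (f : T -> U) (A : set U) :
  continuous f -> closed A -> closed (f @^-1` A).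
Proof. by move=> cf cA; apply: preimage_closed => // x _; exact: cf. Qed.

Lemma measurable_zconf (E : set (borel mset)) : measurable E ->
  measurable ([set z | E z.2] : set (borel Z)).
Proof. by move=> mE; exact: (continuous_measurable continuous_zconf mE). Qed.

Lemma Lambda_separated : exists2 r0, 0 < r0 & separated Lam r0.
Proof.
have [_ _ _ _ [_ ud _]] := hdelone; exact: uniformly_discrete_separated.
Qed.

Lemma measurable_collision_space :
  measurable (collision_space S : set (borel Z)).
Proof.
have [r0 r00 sep] := Lambda_separated.
have [fC _ _ _ _] := hdelone.
(* Fixing the time [k.+1%:R^-1] in the outgoing condition turns it into an intersection of closed
   conditions, as [rep i] is open. The collision space is then a countable union of closed sets. *)
pose A i k : set Z := [set z | [/\ zcolor z = i, frontier (rep i) (zpos z),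
  enorm (zvel z) = 1, (forall t : R, 0 < t < k.+1%:R^-1 ->
     ~ rep i (zpos z + t *: zvel z)) &
  local_set Lam 1 [set X | X (0, i)] (zconf z)]].
have -> : collision_space S = \bigcup_(i in colors S) \bigcup_k A i k.
  apply/seteqP; split.
    move=> [[i [x v]] L] [/= Ci [/= fx v1 [e e0 out]] tL L0].
    exists i => //.
    have [k _ ke] := near_infty_natSinv_lt (PosNum e0).
    exists k => //; split => //=.
      move=> t /andP[t0 tk]; apply: out; rewrite t0 /=.
      exact: lt_trans (ke k (leqnn _)).
    by split => //=; split=> //; apply/in_bstar0; rewrite enorm0.
  move=> [[i' [x v]] L] [i Ci [k _ [/= iE fx v1 out [tL [_ L0]]]]].
  rewrite /zcolor /= in iE; subst i'; split=> //=; split=> //=.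
  by exists k.+1%:R^-1 => //.
apply: fin_bigcup_measurable => // i [s Ss iE].
apply: bigcupT_measurable => k; apply: closed_measurable.
have orep : open (rep i).
  have [_ /(_ s Ss) [os _ _ _ _] _] := hS.
  rewrite -iE (rep_class hS Ss).
  rewrite (_ : shift_set _ _ = (fun x => x + centroid s) @^-1` s).
    by apply: open_comp => // x _; exact: (cvgD cvg_id (cvg_cst _)).
  apply/seteqP; split=> x; first by move=> /shift_setE; rewrite opprK.
  by move=> sx; apply/shift_setE; rewrite opprK.
have -> : A i k = zcolor @^-1` [set i] `&` zpos @^-1` frontier (rep i) `&`
  (enorm \o zvel) @^-1` [set 1] `&`
  \bigcap_(t in [set t : R | 0 < t < k.+1%:R^-1])
     (fun z => zpos z + t *: zvel z) @^-1` (~` rep i) `&`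
  zconf @^-1` local_set Lam 1 [set X | X (0, i)].
  apply/seteqP; split=> z; first by move=> [].
  by move=> [[[[]]]].
apply: closedI; [apply: closedI; [apply: closedI; [apply: closedI|]|]|].
- by apply: closed_preim continuous_zcolor _; exact: discrete_closed.
- apply: closed_preim continuous_zpos _.
  by apply: closedI; exact: closed_closure.
- apply: closed_preim; last exact: closed_eq.
  exact: continuous_compT continuous_zvel (@continuous_enorm R d).
- apply: closed_bigI => t _; apply: closed_preim; last by rewrite closedC.
  move=> z; apply: cvgD; first exact: continuous_zpos.
  by apply: cvgZr; exact: continuous_zvel.
- by apply: closed_preim continuous_zconf _;
  exact: closed_local_set r00 sep _ _.
Qed.

End CollisionSpace.

Section AbsoluteContinuity.
Context {R : realType} {d : nat}.
Local Notation rV := 'rV[R]_d.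
Local Notation mset := (multiset R d (color R d)).
Local Notation Z := (phase_space R d).
Variable S : set (set rV).
Hypothesis hS : scatterer_configuration S.
Hypothesis hdelone : delone_multiset (colors S) (Lambda S).
Local Notation Lam := (Lambda S).

Definition ratv (q : {ffun 'I_d -> rat}) : rV := \row_k ratr (q k).

Lemma ratv_dense (x : rV) e : 0 < e -> exists q, ball (ratv q) e x.
Proof.
move=> e0.
have H k : exists q : rat, `|ratr q - x 0 k| < e.
  have [q] := @rat_in_itvoo R (x 0 k - e) (x 0 k + e) ltac:(lra).
  by rewrite in_itv /= => qx; exists q; rewrite ltr_norml; lra.
have [f hf] := choice H; exists [ffun k => f k].
by split=> // i k; rewrite (ord1 i) /ratv mxE ffunE; exact: hf.
Qed.

(* A countable family of measurable sets that refines every neighborhood in the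
   collision space. *)
Definition cell (j : nat * ({ffun 'I_d -> rat} * {ffun 'I_d -> rat}) *
    (color R d * rV)) : set Z :=
  let: (k, (q1, q2), (i, p)) := j in
  [set z | [/\ zcolor z = i, ball (ratv q1) k.+1%:R^-1 (zpos z),
     ball (ratv q2) k.+1%:R^-1 (zvel z) &
     local_set Lam k.+1%:R [set centered_cluster Lam k.+1%:R p] (zconf z)]].

Lemma measurable_cell j : measurable (cell j : set (borel Z)).
Proof.
have [r0 r00 sep] := Lambda_separated hdelone.
case: j => [[k [q1 q2]] [i p]] /=.
rewrite (_ : [set z | _] = zcolor @^-1` [set i] `&`
  (zpos @^-1` ball (ratv q1) k.+1%:R^-1) `&`
  (zvel @^-1` ball (ratv q2) k.+1%:R^-1) `&`
  [set z : Z | local_set Lam k.+1%:R [set centered_cluster Lam k.+1%:R p] z.2]);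
  last first.
  by apply/seteqP; split=> z; [move=> []|move=> [[[]]]].
apply: measurableI; last first.
  by apply: measurable_zconf; exact: (measurable_local_set r00 sep).
apply: measurableI; last first.
  apply: open_measurable_borel; apply: open_comp; last exact: ball_open.
  by move=> z _; exact: continuous_zvel.
apply: measurableI; last first.
  apply: open_measurable_borel; apply: open_comp; last exact: ball_open.
  by move=> z _; exact: continuous_zpos.
apply: open_measurable_borel; apply: open_comp; last exact: discrete_open.
by move=> z _; exact: continuous_zcolor.
Qed.

Lemma cell_basis (U : set Z) z : open U -> U z -> collision_space S z ->
  exists j, [/\ colors S j.2.1, supp Lam j.2.2, cell j z & cell j `<=` U].
Proof.
move: z => [[i [x v]] L] oU Uz [/= Ci _ tL L0].
have : nbhs (i : discrete_topology (color R d), (x, v), L) U.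
  by apply: open_nbhs_nbhs; split.
move=> [[A W] /= [NA WL] AW].
move: NA => [[A1 A2] /= [A1i NA2] A12].
move: NA2 => [[B1 B2] /= [B1x B2v] B12].
move: B1x => /(@nbhs_ballP R) [e1 /= e10 hB1].
move: B2v => /(@nbhs_ballP R) [e2 /= e20 hB2].
move: WL => /(@nbhs_ballP R) [e3 /= e30 hW].
pose e := Num.min e1 (Num.min e2 e3).
(* Half of [e], since the rational center of a cell is itself only within [a] of the given point. *)
have e0 : 0 < e / 2 by rewrite divr_gt0 // !lt_min e10 e20.
have [k _ /(_ k (leqnn _)) /= ke] := near_infty_natSinv_lt (PosNum e0).
set a : R := k.+1%:R^-1 in ke.
have a0 : 0 < a by rewrite invr_gt0.
have [q1 hq1] := ratv_dense x a0; have [q2 hq2] := ratv_dense v a0.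
have [p Lp pE] := transversal_local k.+1%:R tL.
have ee1 : a + a <= e1.
  by have : e <= e1; [rewrite ge_min lexx|lra].
have ee2 : a + a <= e2.
  by have : e <= e2; [rewrite !ge_min lexx orbT|lra].
have ee3 : a < e3.
  by have : e <= e3; [rewrite !ge_min lexx !orbT|lra].
exists (k, (q1, q2), (i, p)); split=> //.
move=> [[i' [x' v']] L'] /= [iE bx bv]; rewrite /zconf /= => -[_ L'E].
rewrite /zcolor /zpos /zvel /= in iE bx bv; subst i'.
apply: AW; split; last first.
  apply: hW; apply/mset_dist_lt; right; exists a => //; split=> //.
  by exists 0, 0; rewrite /a invrK !phi0 L'E pE; split=> //;
    rewrite /cball /= subr0 enorm0 ltW.
apply: A12; split; first exact: nbhs_singleton.
apply: B12; split.
  by apply: hB1; apply: le_ball ee1 _ _; apply: ball_triangle bx;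
    exact: ball_sym.
by apply: hB2; apply: le_ball ee2 _ _; apply: ball_triangle bv; exact: ball_sym.
Qed.

Variables (L1 : color R d -> {finite_measure set (borel rV) -> \bar R})
  (nu : {finite_measure set (borel mset) -> \bar R})
  (L2 : {finite_measure set (borel rV) -> \bar R})
  (mu : probability (borel Z) R).
Hypothesis hac : locally_abs_continuous S L1 nu L2 mu.

(** Local absolute continuity speaks of one neighborhood per point; the countably many cells
    contained in such neighborhoods already cover the collision space. *)
Lemma abs_continuous_null (E : set (borel mset)) : measurable E ->
  nu E = 0%E -> mu (collision_space S `&` [set z | E z.2]) = 0%E.
Proof.
move=> mE E0.
have [_ _ _ _ [cL _ _]] := hdelone; have [fC _ _ _ _] := hdelone.
have mD := measurable_collision_space hS hdelone.
pose DE : set (borel Z) := collision_space S `&` [set z | E z.2].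
have mDE : measurable DE by apply: measurableI => //; exact: measurable_zconf.
pose J := [set j | (setT `*` (setT `*` setT) `*` (colors S `*` supp Lam)) j /\
  mu.-negligible (cell j `&` DE)].
have cJ : countable J.
  apply: (@sub_countable _ _ _
    (setT `*` (setT `*` setT) `*` (colors S `*` supp Lam))).
    by apply: subset_card_le => j [].
  apply: countableX; first by apply: countableX; [|apply: countableX];
    exact: countableP.
  by apply: countableX => //; exact: finite_set_countable.
have H : mu.-negligible DE.
  suff sub : DE `<=` \bigcup_(j in J) (cell j `&` DE).
    by apply: negligibleS sub _; apply: countable_bigcup_null => // j [].
  move=> z [Dz Ez]; have [U [oU Uz hU]] := hac Dz.
  have [j [Cj Lj cz cU]] := cell_basis oU Uz Dz.
  exists j => //; split; first by case: j Cj Lj {cz cU}.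
  exists (cell j `&` DE); split => //.
    by apply: measurableI => //; exact: measurable_cell.
  apply: hU => [||i Ci].
  - by apply: measurableI => //; exact: measurable_cell.
  - by move=> w [/cU ? []].
  - by apply: (@product_measure_null _ _ _ _ _ _ _ (L1 i) nu L2 E _ mE E0) => w
    [_ []].
by move: H => /(negligibleP _ mDE).
Qed.

End AbsoluteContinuity.

Section UniformBound.
Context {R : realType} {d : nat}.
Local Notation rV := 'rV[R]_d.
Local Notation mset := (multiset R d (color R d)).
Local Notation Z := (phase_space R d).
Variable S : set (set rV).
Hypothesis hS : scatterer_configuration S.
Hypothesis hdelone : delone_multiset (colors S) (Lambda S).
Hypothesis hflc : finite_local_complexity (Lambda S).
Hypothesis haper : aperiodic (Lambda S).
Hypothesis hrep : linearly_repetitive (Lambda S).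
Local Notation Lam := (Lambda S).
Variables (L1 : color R d -> {finite_measure set (borel rV) -> \bar R})
  (nu : {finite_measure set (borel mset) -> \bar R})
  (L2 : {finite_measure set (borel rV) -> \bar R})
  (mu : probability (borel Z) R).
Hypothesis hnu : frequency_measure Lam nu.
Hypothesis hac : locally_abs_continuous S L1 nu L2 mu.
Variable k0 : 'I_d.

(* Otherwise the upper limit of exceptional neighborhoods of summable
   [nu]-measures would be [nu]-null and of positive [mu]-measure. *)
Lemma near_cluster_mass : exists (c R1 : R), [/\ 0 < c, 0 < R1 &
  forall r, R1 <= r -> forall p0, supp Lam p0 ->
  (mu (collision_space S `&`
       [set z | local_set Lam (r + c * r)%R (near_cluster Lam (c * r)%R r p0)
         z.2])
   <= (2^-1)%:E)%E].
Proof.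
have [r0 r00 sep] := Lambda_separated hdelone.
have [Lc rep_Lam] := hrep.
apply: contrapT => H.
pose A := fine (nu (canonical_transversal Lam)).
have mF r Q : measurable (local_set Lam r Q : set (borel mset)).
  exact: (measurable_local_set r00 sep).
have mD := measurable_collision_space hS hdelone.
(* If no pair [c], [R1] works, the pair that [near_cluster_frequency] gives for [m = 2 ^ k.+1] fails
   at some scale; the resulting [nu]-measures have sum at most [2 * A]. *)
have bad k : exists z : R * set mset,
    fine (nu (local_set Lam z.1 z.2)) <= 2 * A / (2 ^ k.+1)%:R /\
    ((2^-1)%:E <= mu (collision_space S `&` [set w | local_set Lam z.1 z.2
      w.2]))%E.
  have [c [R1 [c0 R10 hc]]] := near_cluster_frequency r00 sep hflc hnu rep_Lam
    haper k0 (expn_gt0 2 k.+1).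
  apply: contrapT => nb; apply: H; exists c, R1; split=> // r rR p0 Lp0.
  rewrite leNgt; apply/negP => lt; apply: nb.
  exists (r + c * r, near_cluster Lam (c * r) r p0); split=> /=;
    last exact: ltW.
  by rewrite ler_pdivlMr ?ltr0n ?expn_gt0 //; exact: hc.
have [f hf] := choice bad.
pose F k : set (borel mset) := local_set Lam (f k).1 (f k).2.
pose G k : set (borel Z) := collision_space S `&` [set z | F k z.2].
have mG k : measurable (G k).
  by apply: measurableI => //; apply: measurable_zconf; exact: mF.
have A0 : 0 <= A by rewrite fine_ge0.
have F0 : nu (lim_sup_set F) = 0%E.
  apply: lim_sup_set_cvg0 => [k|]; first exact: mF.
  apply: (@le_lt_trans _ _ (2 * A)%:E); last exact: ltry.
  apply: le_trans (epsilon_trick0 _ (mulr_ge0 _ A0)) => //.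
  apply: lee_nneseries => // k _.
  rewrite -[leLHS]fineK ?fin_num_measure //; last exact: mF.
  by rewrite lee_fin; exact: (hf k).1.
have mlF : measurable (lim_sup_set F).
  by apply: bigcapT_measurable => n; apply: bigcup_measurable => k _; exact: mF.
have := abs_continuous_null hS hdelone hac mlF F0.
have sub : lim_sup_set G `<=` collision_space S `&` [set z | lim_sup_set F z.2].
  move=> z Gz; split; first by have [k _ []] := Gz 0%N Logic.I.
  by move=> n _; have [k nk [_ Fk]] := Gz n Logic.I; exists k.
(* As [mu] is finite, the measures of the tail unions, each at least 1/2, converge to that of the
   upper limit. *)
have le1 : ((2^-1)%:E <= mu (lim_sup_set G))%E.
  have := lim_sup_set_cvg mu G mG _.
  rewrite (le_lt_trans (probability_le1 _ _)) ?ltry //; last first.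
    by apply: bigcup_measurable => k _; exact: mG.
  move=> /(_ isT) cv; apply: (cvge_ge _ cv); apply: nearW => n.
  apply: le_trans (hf n).2 _; apply: le_measure; rewrite ?inE; first exact: mG.
    by apply: bigcup_measurable => k _; exact: mG.
  by move=> z Gz; exists n => //=.
move=> E0; move: le1; rewrite leNgt => /negP; apply.
apply: (@le_lt_trans _ _ 0%E); last by rewrite lte_fin.
rewrite -E0; apply: le_measure; rewrite ?inE //.
  by apply: bigcapT_measurable => n; apply: bigcup_measurable => k _; exact: mG.
by apply: measurableI => //; exact: measurable_zconf.
Qed.

End UniformBound.

(** * Correlations of local observables *)

Section Holder.
Context {R : realType} {d : nat}.
Local Notation rV := 'rV[R]_d.
Local Notation mset := (multiset R d (color R d)).
Local Notation Z := (phase_space R d).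
Variable S : set (set rV).
Hypothesis hS : scatterer_configuration S.
Hypothesis hdelone : delone_multiset (colors S) (Lambda S).
Hypothesis haper : aperiodic (Lambda S).
Local Notation Lam := (Lambda S).
Local Notation D := (collision_space S).
Variable k0 : 'I_d.

(** The Hoelder seminorm is a supremum in the extended reals, which over no pairs at all would be
    [-oo]; such a pair makes it nonnegative. *)
Lemma collision_pair : D !=set0 ->
  exists z1 z2 : Z, [/\ D z1, D z2, z1.1 = z2.1 & z1.2 <> z2.2].
Proof.
move=> [[[i [x v]] L] [/= Ci T1 _ _]].
have [_ _ /(_ i Ci) [_ _ [r r0 dense]] _ _] := hdelone.
have [p [/= Lp pr]] := dense 0.
(* The balls of radius [r] about the origin and this center are disjoint, so [p] and [q] differ, and
   aperiodicity separates the two translates. *)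
have [q [/= Lq qr]] := dense ((3 * r) *: delta_mx 0 k0).
have Dphi p' : layer Lam i p' -> D ((i, (x, v)), phi p' Lam).
  move=> Lp'; split=> //=; last by rewrite /phi /= add0r.
  split; first exact: hull_self_phi.
  by exists i; rewrite /phi /= add0r.
exists ((i, (x, v)), phi p Lam), ((i, (x, v)), phi q Lam); split.
- exact: Dphi.
- exact: Dphi.
- by [].
move=> /= E; have pq : p - q = 0.
  by apply: haper; rewrite addrC -phi_phi E phi_phi addNr phi0.
move: pr qr; rewrite /cball /= subr0 (subr0_eq pq) => pr qr.
have e1 : enorm (delta_mx 0 k0 : rV) = 1.
  rewrite /enorm /dotp (bigD1 k0) //= big1 ?addr0 ?mxE ?eqxx ?mul1r ?sqrtr1 //.
  by move=> j jk; rewrite !mxE eqxx /= (negbTE jk) mul0r.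
have := enormD ((3 * r) *: delta_mx 0 k0 - q) q.
by rewrite subrK enormB enormZ e1 mulr1 ger0_norm; lra.
Qed.

Lemma holder_norm_ge0 alpha psi : D !=set0 ->
  (0 <= holder_norm D alpha psi)%E.
Proof.
move=> D0; have [z1 [z2 [Dz1 Dz2 z12 zn]]] := collision_pair D0.
apply: adde_ge0.
  apply: (@le_trans _ _ (`|psi z1|)%:E); first by rewrite lee_fin.
  by apply: ereal_sup_ubound; exists z1.
apply: (@le_trans _ _
    (`|psi z1 - psi z2| / mset_dist z1.2 z2.2 `^ alpha)%:E).
  by rewrite lee_fin divr_ge0 // powR_ge0.
by apply: ereal_sup_ubound; exists z1, z2; split.
Qed.

Definition local_indic r (Q : set mset) (z : Z) : R :=
  \1_[set w : Z | Q (bstar r 0 `&` w.2)] z.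

Lemma local_indic_bounds r Q z : 0 <= local_indic r Q z <= 1.
Proof. by rewrite /local_indic indicE; case: (_ \in _);
  rewrite ?lexx ler01. Qed.

Variables (r0 e r : R).
Hypothesis sep : separated Lam r0.
Hypothesis e0 : 0 < e.
Hypothesis es : e <= (Num.sqrt 2)^-1.
Hypothesis er0 : e + e <= r0.
Hypothesis re : r + e <= e^-1.

Lemma local_indic_near Q z1 z2 : D z1 -> D z2 -> mset_dist z1.2 z2.2 < e ->
  local_indic r Q z1 = local_indic r Q z2.
Proof.
move=> [_ _ [h1 s1] _] [_ _ t2 _] d12; rewrite /local_indic !indicE.
have E := transversal_near sep e0 es er0 re h1 t2 s1 d12.
by congr ((_ : bool)%:R); apply/idP/idP; rewrite !inE /= E.
Qed.

(** Configurations closer than [e] give equal values; for the others the quotient is at most 1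
    divided by the power [alpha] of [e]. *)
Lemma local_indic_holder alpha Q : 0 < alpha ->
  holder_space D alpha (local_indic r Q) /\
  (holder_norm D alpha (local_indic r Q) <= (1 + e^-1 `^ alpha)%:E)%E.
Proof.
move=> al0.
have hs : (holder_seminorm D alpha (local_indic r Q) <= (e^-1 `^ alpha)%:E)%E.
  apply: ge_ereal_sup => _ [z1 [z2 [D1 D2 _ _ ->]]]; rewrite lee_fin.
  have [near|far] := ltP (mset_dist z1.2 z2.2) e.
    by rewrite (local_indic_near Q D1 D2 near) subrr normr0 mul0r powR_ge0.
  have ea : e `^ alpha <= mset_dist z1.2 z2.2 `^ alpha.
    apply: (ge0_ler_powR (ltW al0)) => //; rewrite nnegrE; first exact: ltW.
    exact: le_trans (ltW e0) far.
  have ea0 : 0 < e `^ alpha by rewrite powR_gt0.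
  have -> : e^-1 `^ alpha = (e `^ alpha)^-1.
    by rewrite -(powR_inv1 (ltW e0)) -powRrM mulN1r powRN.
  apply: (@le_trans _ _ (1 * (mset_dist z1.2 z2.2 `^ alpha)^-1)).
    rewrite ler_wpM2r ?invr_ge0 ?powR_ge0 //.
    have := local_indic_bounds r Q z1; have := local_indic_bounds r Q z2.
    by rewrite ler_norml; lra.
  by rewrite mul1r lef_pV2 ?posrE //; exact: lt_le_trans ea.
split; last first.
  rewrite EFinD; apply: leeD => //; apply: ge_ereal_sup => _ [z _ <-].
  have /andP[i0 i1] := local_indic_bounds r Q z.
  by rewrite lee_fin ger0_norm.
split; last by apply: le_lt_trans hs _; rewrite ltry.
apply/subspace_continuousP => z Dz B /nbhs_singleton Bz.
have : nbhs z (zconf @^-1` ball z.2 e).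
  by apply: continuous_zconf; exact: nbhsx_ballx.
apply: filterS => w /= zw Dw.
suff : B (local_indic r Q w) by [].
by rewrite -(local_indic_near Q Dz Dw zw); exact: Bz.
Qed.

End Holder.

(** Here [x] is the number of collisions. The cluster radius [r] is proportional to it so that
    [c * r] exceeds the displacement [x * M1]; [rho] is the radius on which both observables depend,
    and [e] is the distance below which they are constant, with [e^-1] of order [x]. *)
Lemma mixing_scale {R : realType} (c R1 M1 r0 x : R) (a := (M1 + 1) / c)
    (r := a * x) (rho := r + c * r) (e := (rho + 1)^-1) :
  0 < c -> 0 < R1 -> 0 <= M1 -> 0 < r0 ->
  1 <= x -> (R1 + 1) / a + 2 + 2 / r0 <= x ->
  [/\ 0 < a, R1 + 1 <= r, c * r = (M1 + 1) * x,
      rho + 1 <= (a + M1 + 2) * x &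
      [/\ 0 < rho, 0 < e, e <= (Num.sqrt 2)^-1, e + e <= r0 &
          rho + e <= e^-1]].
Proof.
move=> c0 R10 M10 r00 x1 xbig.
have a0 : 0 < a by rewrite divr_gt0 //; lra.
have Ra : 0 < (R1 + 1) / a by rewrite divr_gt0 //; lra.
have r02 : 0 < 2 / r0 by rewrite divr_gt0.
have x2 : 2 + 2 / r0 <= x by lra.
have rR : R1 + 1 <= r by rewrite /r mulrC -ler_pdivrMr //; lra.
have crE : c * r = (M1 + 1) * x.
  by rewrite /r mulrA /a mulrCA divff ?mulr1 // gt_eqF.
have crx : x <= c * r by rewrite crE ler_peMl //; lra.
have rhox : x + 1 <= rho by rewrite /rho; lra.
clear xbig Ra.
have rho1 : 0 < rho + 1 by lra.
have e0 : 0 < e by rewrite invr_gt0.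
have s2 : Num.sqrt 2 <= 2 :> R.
  rewrite -[leRHS]ger0_norm // -sqrtr_sqr ler_sqrt //.
  by rewrite expr2; lra.
split=> //.
  have -> : (a + M1 + 2) * x = r + (M1 + 1) * x + x by rewrite /r; ring.
  by rewrite /rho crE lerD2l.
split=> //; first lra.
- by rewrite lef_pV2 ?posrE ?sqrtr_gt0 //; lra.
- have : e <= (2 / r0)^-1 by rewrite lef_pV2 ?posrE //; lra.
  by rewrite invf_div; lra.
- have e1 : e <= 1 by rewrite invf_le1 //; lra.
  by rewrite /e invrK lerD2l.
Qed.

Section LowerBound.
Context {R : realType} {d : nat}.
Local Notation rV := 'rV[R]_d.
Local Notation mset := (multiset R d (color R d)).
Local Notation Z := (phase_space R d).
Variable S : set (set rV).
Hypothesis hS : scatterer_configuration S.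
Hypothesis hdelone : delone_multiset (colors S) (Lambda S).
Hypothesis hflc : finite_local_complexity (Lambda S).
Hypothesis haper : aperiodic (Lambda S).
Hypothesis hrep : linearly_repetitive (Lambda S).
Hypothesis hhor : finite_horizon S.
Local Notation Lam := (Lambda S).
Local Notation D := (collision_space S).
Variables (L1 : color R d -> {finite_measure set (borel rV) -> \bar R})
  (nu : {finite_measure set (borel mset) -> \bar R})
  (L2 : {finite_measure set (borel rV) -> \bar R})
  (mu : probability (borel Z) R).
Hypothesis hnu : frequency_measure Lam nu.
Hypothesis hac : locally_abs_continuous S L1 nu L2 mu.
Hypothesis muD : mu (~` D) = 0%E.
Variable k0 : 'I_d.

Definition local_event r Q : set (borel Z) :=
  D `&` [set z | local_set Lam r Q z.2].

Lemma mem_local_event r Q z : D z ->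
  local_event r Q z <-> Q (bstar r 0 `&` z.2).
Proof. by move=> Dz; split=> [[_ []]|Qz] //; have [_ _ tL _] := Dz. Qed.

Lemma measurable_local_event r Q : measurable (local_event r Q).
Proof.
have [r0 r00 sep] := Lambda_separated hdelone.
apply: measurableI; first exact: measurable_collision_space.
by apply: measurable_zconf; exact: (measurable_local_set r00 sep).
Qed.

Lemma mu_collision_space : mu D = 1%E.
Proof.
have mD := measurable_collision_space hS hdelone.
by rewrite -[D]setCK probability_setC ?muD ?sube0 //; exact: measurableC.
Qed.

(** By repetitivity, every [r]-cluster is one centered at a point of [Lam] in the ball of radius
    [Lc * r + 1] about 0. The corresponding events cover the collision space, so one of them has at
    least the average measure. *)
Lemma frequent_cluster : exists2 C : R, 0 < C & forall r, 1 <= r ->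
  exists2 p0, supp Lam p0 &
  ((C * r ^+ d)^-1%:E <= mu (local_event r [set centered_cluster Lam r p0]))%E.
Proof.
have [r0 r00 sep] := Lambda_separated hdelone.
have [Lc rep_Lam] := hrep; have [Lc1 _] := rep_Lam.
have [C0 C00 hC] := separated_count r00 sep.
have Lc0 : 0 < Lc by lra.
have Lc2 : 0 < Lc + 2 by lra.
have CL : 0 < C0 * (Lc + 2) ^+ d by rewrite mulr_gt0 // exprn_gt0.
exists (C0 * (Lc + 2) ^+ d + 1) => [|r r1]; first by rewrite addr_gt0.
have r_gt0 : 0 < r by lra.
set b := (_ * _)^-1; apply: contrapT => H.
have rp : 0 <= Lc * r + 1 by rewrite addr_ge0 // mulr_ge0 // ltW.
have [fP leP] := hC 0 _ rp.
pose P := points Lam 0 (Lc * r + 1); pose K := count_set P.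
have Kb : K%:R * b < 1.
  rewrite /b ltr_pdivrMr ?mul1r; last by rewrite mulr_gt0 ?addr_gt0 ?exprn_gt0.
  apply: le_lt_trans leP _; rewrite mulrDl mul1r.
  apply: (@le_lt_trans _ _ (C0 * (Lc + 2) ^+ d * r ^+ d)); last first.
    by rewrite ltrDl exprn_gt0.
  rewrite -mulrA ler_pM2l // -exprMn lerXn2r ?nnegrE //.
  - by rewrite addr_ge0.
  - by rewrite mulr_ge0 // ltW.
  - by rewrite mulrDl -addrA lerD2l -[1 + 1]/(2 : R) ler_peMr.
have : (mu D <= \sum_(q \in P) mu (local_event r [set centered_cluster Lam r
  q]))%E.
  apply: content_sub_fsum => //.
  - by move=> q _; exact: measurable_local_event.
  - exact: measurable_collision_space.
  - move=> z Dz; have [_ _ tL _] := Dz.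
    have [p Lp pE] := transversal_local r tL.
    have [q [Lq qT qE]] := repetitive_copy rep_Lam 0 r1 Lp.
    by exists q => //; apply/mem_local_event => //=; rewrite pE qE.
rewrite mu_collision_space fsbig_finite // leNgt => /negP; apply.
apply: (@le_lt_trans _ _ (K%:R * b)%:E); last by rewrite lte_fin.
have -> : (K%:R * b)%:E = (\sum_(q <- fset_set P) b%:E)%E.
  by rewrite sumEFin big_const_seq count_predT iter_addr addr0 -[in
    RHS]mulr_natl.
rewrite big_seq_cond [leRHS]big_seq_cond; apply: lee_sum => q.
rewrite andbT => /mem_fset_set_iff [] // Lq _.
rewrite leNgt; apply/negP => lt; apply: H; exists q => //; exact: ltW.
Qed.

Lemma integral_local_indic r Q :
  (\int[mu]_(z in D) (local_indic r Q z)%:E)%E = mu (local_event r Q).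
Proof.
have mD := measurable_collision_space hS hdelone.
have mE := measurable_local_event r Q.
transitivity (\int[mu]_(z in D) (\1_(local_event r Q) z)%:E)%E.
  apply: eq_integral => z /set_mem Dz; rewrite /local_indic !indicE.
  congr ((_ : bool)%:R)%:E.
  have [h1 h2] := mem_local_event r Q Dz.
  by apply/idP/idP => /set_mem H; apply/mem_set; [exact: h2|exact: h1].
by rewrite integral_indic // setIidl // => z [].
Qed.

(** [K] and [n0] depend neither on [n] nor on [b], so this one inequality can be confronted with
    every decay rate. *)
Lemma correlation_lower_bound alpha : 0 < alpha -> exists K (n0 : nat),
  0 < K /\ forall n b, (n0 <= n)%N -> (1 <= n)%N -> 0 <= b ->
  correlation_bound D alpha mu billiard_map n b ->
  1 <= K * b * n%:R `^ (d%:R + 2 * alpha).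
Proof.
move=> al0.
have [r0 r00 sep] := Lambda_separated hdelone.
have [fC _ _ _ _] := hdelone.
have [C C0 hC] := frequent_cluster.
have [c [R1 [c0 R10 hN]]] := near_cluster_mass hS hdelone hflc haper hrep hnu
  hac k0.
have [M1 M10 hM] := billiard_iter_displacement hS fC hhor.
pose a := (M1 + 1) / c; pose B := a + M1 + 2.
have a0 : 0 < a by rewrite divr_gt0 //; lra.
have B0 : 0 < B by rewrite /B; lra.
exists (2 * C * a ^+ d * (1 + B `^ alpha) ^+ 2),
  (Num.truncn ((R1 + 1) / a + 2 + 2 / r0)).+1.
have HB : 0 < 1 + B `^ alpha by have := powR_ge0 B alpha; lra.
split; first by rewrite !mulr_gt0 ?exprn_gt0.
move=> n b n0n n1 b0 hb.
have x1 : 1 <= n%:R :> R by rewrite ler1n.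
set x : R := n%:R in x1 *.
have xbig : (R1 + 1) / a + 2 + 2 / r0 <= x.
  by apply: ltW; apply: lt_le_trans (truncnS_gt _) _; rewrite ler_nat.
have x0 : 0 <= x := le_trans ler01 x1.
have := mixing_scale c0 R10 M10 r00 x1 xbig.
rewrite -/a -/B; set r := a * x; set rho := r + c * r; set e := (rho + 1)^-1.
move=> [_ rR crE rhoB [rho0 e0 es er0 re]].
have R1r : R1 <= r by apply: le_trans rR; rewrite lerDl.
have r1 : 1 <= r by apply: le_trans rR; rewrite lerDr ltW.
have r_gt0 : 0 < r := lt_le_trans ltr01 r1.
have re' : r + e <= e^-1.
  by apply: le_trans re; rewrite lerD2r lerDl mulr_ge0 // ltW.
clear n0n xbig rR.
have [p0 Lp0 hA] := hC r r1.
pose N := near_cluster Lam (c * r) r p0.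
pose Q1 := [set centered_cluster Lam r p0].
have [H1 n1le] := local_indic_holder sep e0 es er0 re' Q1 al0.
have [H2 n2le] := local_indic_holder sep e0 es er0 re (~` N) al0.
have := hb _ _ H1 H2; rewrite /correlation.
(* Pointwise, either the starting configuration has a copy of the cluster within [c * r], and the
   second factor is 0, or the particle cannot have reached one after [n] collisions, and the first
   factor is 0. *)
rewrite (_ : (\int[mu]_(z in D) _)%E = 0%E); last first.
  apply: integral0_eq => z Dz.
  have [p pM pE] : exists2 p, enorm p <= x * M1 &
      (iter n (@billiard_map R d) z).2 = phi p z.2.
    apply: hM; have [_ [fz v1 _] tz L0] := Dz; split=> //; by case: tz.
  have [Nz|nNz] := pselect (N z.2).
    rewrite [X in _ * X](_ : _ = 0) ?mulr0 //.
    rewrite /local_indic indicE memNset // => /=.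
    by apply; apply/near_cluster_local.
  rewrite [X in X * _](_ : _ = 0) ?mul0r //.
  rewrite /local_indic indicE memNset //= pE => E; apply: nNz.
  by exists p => //; apply: le_trans pM _; rewrite crE mulrC ler_wpM2r // lerDl.
rewrite sub0e abseN !integral_local_indic.
have mB : ((2^-1)%:E <= mu (local_event rho (~` N)))%E.
  have DU : D = local_event rho N `|` local_event rho (~` N).
    apply/seteqP; split=> z; last by move=> [[]|[]].
    move=> Dz; have [Nz|Nz] := pselect (N (bstar rho 0 `&` z.2)).
      by left; apply/mem_local_event.
    by right; apply/mem_local_event.
  have : (mu D <= mu (local_event rho N) + mu (local_event rho (~` N)))%E.
    rewrite [in leLHS]DU measureU ?lexx //; [exact: measurable_local_event..|].
    by apply/seteqP; split=> z // [[_ [_ zN]] [_ [_ /(_ zN)]]].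
  rewrite mu_collision_space => le1.
  have leN := hN r R1r p0 Lp0.
  rewrite -(@leeD2lE _ (2^-1)%:E) // -EFinD.
  apply: le_trans (leeD leN (lexx _)).
  by apply: le_trans le1; rewrite lee_fin [leRHS]splitr mul1r.
move=> le.
have Hx : 1 + e^-1 `^ alpha <= (1 + B `^ alpha) * x `^ alpha.
  have xa : 1 <= x `^ alpha.
    by rewrite -(powRr0 x); apply: ler_powR => //; exact: ltW.
  have : e^-1 `^ alpha <= B `^ alpha * x `^ alpha.
    rewrite -powRM ?(ltW B0) //; apply: (ge0_ler_powR (ltW al0)).
    - by rewrite nnegrE invr_ge0 ltW.
    - by rewrite nnegrE mulr_ge0 // ltW.
    - by rewrite /e invrK.
  rewrite mulrDl mul1r; exact: lerD.
have D0 : D !=set0.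
  apply/set0P/eqP => D0; have := mu_collision_space; rewrite D0 measure0.
  by move=> [] /eqP; rewrite eq_sym oner_eq0.
have ln1 := holder_norm_ge0 hdelone haper k0 alpha (local_indic r Q1) D0.
have ln2 := holder_norm_ge0 hdelone haper k0 alpha (local_indic rho (~` N)) D0.
(* A common bound for both Hoelder norms; [H * H] accounts for the summand [2 * alpha] of the
   exponent, and [r ^+ d] for the summand [d]. *)
pose H := (1 + B `^ alpha) * x `^ alpha.
have H0 : 0 < H by rewrite mulr_gt0 // powR_gt0 // (lt_le_trans ltr01).
have fin : (((C * r ^+ d)^-1 * 2^-1)%:E <= (b * H * H)%:E :> \bar R)%E.
  apply: (@le_trans _ _ (mu (local_event r Q1) * mu (local_event rho (~`
    N)))%E).
    rewrite EFinM; apply: lee_pmul => //.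
    by rewrite lee_fin invr_ge0 mulr_ge0 ?exprn_ge0 ?(ltW C0) ?(ltW r_gt0).
  apply: (@le_trans _ _ `|mu (local_event r Q1) * mu (local_event rho (~`
    N))|%E).
    by rewrite gee0_abs // mule_ge0.
  apply: le_trans le _; rewrite !EFinM; apply: lee_pmul => //.
  - by rewrite mule_ge0 // lee_fin.
  - by apply: lee_wpmul2l; [rewrite lee_fin|apply: le_trans n1le _;
    rewrite lee_fin].
  - by apply: le_trans n2le _; rewrite lee_fin.
move: fin; rewrite lee_fin -invfM -div1r ler_pdivrMr; last first.
  by rewrite !mulr_gt0 ?exprn_gt0.
have -> : b * H * H * (C * r ^+ d * 2) =
  2 * C * a ^+ d * (1 + B `^ alpha) ^+ 2 * b * x `^ (d%:R + 2 * alpha);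
    last by [].
rewrite powRD; last by apply/implyP => _; rewrite gt_eqF // (lt_le_trans ltr01).
rewrite powR_mulrn //.
rewrite [2 * alpha]mulrC powRrM -[2]/(2%:R) powR_mulrn ?powR_ge0 //.
rewrite /H /r exprMn; ring.
Qed.

End LowerBound.

(** * Comparison of decay rates and conclusion *)

Section Decay.
Context {R : realType}.

Lemma powR_exponent_le (K s gamma : R) (n0 : nat) :
  (forall n, (n0 <= n)%N -> (1 <= n)%N ->
     1 <= K * n%:R `^ (- gamma) * n%:R `^ s) -> gamma <= s.
Proof.
move=> H; rewrite leNgt; apply/negP => sg.
pose del := gamma - s; have del0 : 0 < del by rewrite subr_gt0.
(* The threshold beyond which the power [del] of [n] exceeds the absolute value of [K]. *)
pose y := `|K| `^ del^-1.
pose n := (n0 + (Num.truncn y).+1)%N.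
have n1 : (1 <= n)%N by rewrite /n addnS.
have x0 : 0 < n%:R :> R by rewrite ltr0n.
have yn : y < n%:R.
  by apply: lt_le_trans (truncnS_gt y) _; rewrite ler_nat leq_addl.
have Kn : `|K| < n%:R `^ del.
  have -> : `|K| = y `^ del by rewrite -powRrM mulVf ?powRr1 // gt_eqF.
  by apply: gt0_ltr_powR; rewrite ?nnegrE ?powR_ge0 // ltW.
have := H n (leq_addr _ _) n1; rewrite leNgt => /negP; apply.
rewrite -mulrA -powRD; last by apply/implyP => _; rewrite gt_eqF.
rewrite (_ : - gamma + s = - del); last by rewrite /del; ring.
rewrite powRN ltr_pdivrMr ?powR_gt0 // mul1r.
exact: le_lt_trans (ler_norm K) Kn.
Qed.

Lemma stretched_exponential_le (tau g gamma : R) : 0 < tau < 1 -> 0 < g ->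
  0 < gamma -> exists2 C : R, 0 < C & forall n : nat, (1 <= n)%N ->
    tau `^ (n%:R `^ g) <= C * n%:R `^ (- gamma).
Proof.
move=> /andP[t0 t1] g0 gam0.
pose lam := - ln tau; have lam0 : 0 < lam by rewrite oppr_gt0 ln_lt0 // t0.
(* With [g * k >= gamma], the power [k] of [y] dominates the required power of [n]. The exponential
   is split into [k] equal factors, each bounded below through [1 + u <= expR u]. *)
pose k := (Num.truncn (gamma / g)).+1.
have kg : gamma / g <= k%:R by exact/ltW/truncnS_gt.
have lk0 : 0 < lam / k%:R by rewrite divr_gt0.
exists ((lam / k%:R) ^- k); first by rewrite invr_gt0 exprn_gt0.
move=> n n1; have x1 : 1 <= n%:R :> R by rewrite ler1n.
set y := n%:R `^ g.
have y1 : 1 <= y.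
  by rewrite /y -[leLHS](powRr0 n%:R); apply: ler_powR => //; exact: ltW.
have y0 : 0 < y by lra.
have -> : tau `^ y = (expR (lam / k%:R * y) ^+ k)^-1.
  rewrite -expRM_natl -expRN /powR gt_eqF //; congr expR.
  by rewrite /lam; field; rewrite pnatr_eq0.
rewrite powRN -invfM lef_pV2 ?posrE ?mulr_gt0 ?exprn_gt0 ?powR_gt0 ?expR_gt0 //;
  last by lra.
apply: (@le_trans _ _ ((lam / k%:R) ^+ k * y ^+ k)).
  rewrite ler_pM2l ?exprn_gt0 // -powR_mulrn ?(ltW y0) // /y -powRrM.
  by apply: ler_powR => //; rewrite -ler_pdivrMl // mulrC.
rewrite -exprMn lerXn2r ?nnegrE ?mulr_ge0 ?expR_ge0 ?(ltW lk0) ?(ltW y0) //.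
  exact: ltW.
by apply: le_trans (expR_ge1Dx _); rewrite lerDr.
Qed.

End Decay.

Section Conclusion.
Context {R : realType} {d : nat}.
Local Notation Z := (phase_space R d).

(** Monotonicity in the constant rests on the nonnegativity of the extended-real Hoelder norms. *)
Lemma correlation_bound_le (S : set (set 'rV[R]_d)) (k0 : 'I_d)
    (mu : probability (borel Z) R) (alpha : R) n (b b' : R) :
  delone_multiset (colors S) (Lambda S) -> aperiodic (Lambda S) ->
  collision_space S !=set0 -> 0 <= b -> b <= b' ->
  correlation_bound (collision_space S) alpha mu billiard_map n b ->
  correlation_bound (collision_space S) alpha mu billiard_map n b'.
Proof.
move=> hdelone haper D0 b0 bb' hb psi1 psi2 h1 h2.
have n1 := holder_norm_ge0 hdelone haper k0 alpha psi1 D0.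
have n2 := holder_norm_ge0 hdelone haper k0 alpha psi2 D0.
apply: le_trans (hb _ _ h1 h2) _; apply: lee_wpmul2r => //.
by apply: lee_wpmul2r => //; rewrite lee_fin.
Qed.

End Conclusion.

Unset Implicit Arguments.

Theorem theorem1 (R : realType) (d : nat) (hd : (2 <= d)%N)
  (S : set (set 'rV[R]_d))
  (hS : scatterer_configuration S)
  (hdelone : delone_multiset (colors S) (Lambda S))
  (hflc : finite_local_complexity (Lambda S))
  (haper : aperiodic (Lambda S))
  (hrep : linearly_repetitive (Lambda S))
  (hhor : finite_horizon S)
  (hhyp1 : nontrivial_nice_tower (Lambda S))
  (nu : {finite_measure set (borel (multiset R d (color R d))) -> \bar R})
  (hnu : frequency_measure (Lambda S) nu)
  (L1 : color R d -> {finite_measure set (borel 'rV[R]_d) -> \bar R})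
  (hL1 : forall i, colors S i ->
     hypersurface_measure (frontier (rep i)) (L1 i))
  (L2 : {finite_measure set (borel 'rV[R]_d) -> \bar R})
  (hL2 : hypersurface_measure [set v | enorm v = 1] L2)
  (mu : probability (borel (phase_space R d)) R)
  (hmu_inv : invariant_probability (collision_space S) billiard_map mu)
  (hmu_ac : locally_abs_continuous S L1 nu L2 mu)
  (hmu_unique : forall mu' : probability (borel (phase_space R d)) R,
     invariant_probability (collision_space S) billiard_map mu' ->
     locally_abs_continuous S L1 nu L2 mu' ->
     forall A : set (borel (phase_space R d)), measurable A -> mu' A = mu A) :
  (forall alpha : R, 0 < alpha ->
     ~ exists C tau : R, [/\ 0 < C, 0 < tau < 1 &
         forall n : nat, correlation_bound (collision_space S) alpha
           mu billiard_map n (C * tau ^+ n)]) /\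
  (forall alpha : R, 0 < alpha ->
     ~ exists C gamma tau : R, [/\ 0 < C, 0 < gamma < 1, 0 < tau < 1 &
         forall n : nat, correlation_bound (collision_space S) alpha
           mu billiard_map n (C * tau `^ (n%:R `^ gamma))]) /\
  (forall alpha C gamma : R, 0 < alpha -> 0 < C ->
     (forall n : nat, (1 <= n)%N -> correlation_bound (collision_space S) alpha
        mu billiard_map n (C * n%:R `^ (- gamma))) ->
     gamma <= 2 * (d%:R + alpha)).
Proof.
pose k0 : 'I_d := Ordinal (ltnW hd).
have muD := hmu_inv.1.
have D0 : collision_space S !=set0.
  apply/set0P/eqP => D0.
  have := mu_collision_space hS hdelone muD; rewrite D0 measure0.
  by move=> [] /eqP; rewrite eq_sym oner_eq0.
have rate alpha C gamma : 0 < alpha -> 0 < C ->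
    (forall n : nat, (1 <= n)%N -> correlation_bound (collision_space S) alpha
        mu billiard_map n (C * n%:R `^ (- gamma))) ->
    gamma <= d%:R + 2 * alpha.
  move=> al0 C0 hb.
  have [K [n0 [K0 hK]]] := correlation_lower_bound hS hdelone hflc haper hrep
    hhor hnu hmu_ac muD k0 al0.
  apply: (@powR_exponent_le _ (K * C) _ _ n0) => n n0n n1.
  rewrite -(mulrA K); apply: hK => //; last exact: hb.
  by rewrite mulr_ge0 ?powR_ge0 // ltW.
have not_stretched alpha C g tau : 0 < alpha -> 0 < C -> 0 < g -> 0 < tau < 1 ->
    ~ forall n : nat, (1 <= n)%N -> correlation_bound (collision_space S) alpha
        mu billiard_map n (C * tau `^ (n%:R `^ g)).
  move=> al0 C0 g0 t01 hb.
  have s0 : 0 < d%:R + 2 * alpha + 1 by have : 0 <= d%:R :> R by []; lra.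
  have [C' C'0 hC'] := stretched_exponential_le t01 g0 s0.
  (* Stretched exponential decay would imply polynomial decay with an exponent one larger than the
     admissible one. *)
  have := rate alpha (C * C') (d%:R + 2 * alpha + 1) al0 (mulr_gt0 C0 C'0).
  rewrite leNgt ltrDl ltr01 => H; suff: false by []; apply: H => n n1.
  apply: (correlation_bound_le k0 hdelone haper D0 _ _ (hb n n1)).
    by rewrite mulr_ge0 ?powR_ge0 // ltW.
  by rewrite -mulrA ler_pM2l // hC'.
split; [|split].
- move=> alpha al0 [C [tau [C0 t01 hb]]].
  (* Exponential decay is the case of stretching exponent 1, which [not_stretched] covers because it
     allows every [g > 0]. *)
  apply: (not_stretched alpha C 1 tau al0 C0 ltr01 t01) => n _.
  by have := hb n; rewrite powRr1 // powR_mulrn // ltW //; case/andP: t01.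
- move=> alpha al0 [C [g [tau [C0 /andP[g0 _] t01 hb]]]].
  by apply: (not_stretched alpha C g tau al0 C0 g0 t01) => n _.
(* The exponent obtained is [d + 2 * alpha], which is at most [2 * (d + alpha)]. *)
- move=> alpha C gamma al0 C0 hb; have := rate _ _ _ al0 C0 hb.
  by have : 0 <= d%:R :> R by []; lra.
Qed.
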